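(* Let $\mathcal{D}$ be the set of link diagrams with both checkerboard graphs connected. Let $\sim_1$ be the finest equivalence relation on $\mathcal{D}$ with $D\sim_1 D'$ whenever one of the signed checkerboard graphs of $D$ is isomorphic (as a signed graph) to one of the signed checkerboard graphs of $D'$. Let $\sim_2$ be the finest equivalence relation on $\mathcal{D}$ with $D\sim_2 D'$ whenever one of the signed checkerboard graphs of $D$ is 2-isomorphic (as a signed graph) to one of the signed checkerboard graphs of $D'$. Then $\sim_1$ and $\sim_2$ are the same equivalence relation on $\mathcal{D}$.
   Context: Graphs are finite and may have loops and multiple edges. A (classical) link is a collection of finitely many pairwise disjoint, piecewise smooth simple closed curves in $\mathbb R^3$ (or $\mathbb S^3$). A diagram of a link is obtained from a regular projection (a projection in a plane with only finitely many singularities, all of them transverse double points, called crossings) by removing two short arcs at each crossing to indicate which of the two segments is farther from the observer (the underpassing one). Checkerboard graphs: The complementary regions of a link diagram can be 2-colored checkerboard fashion, with colors ''shaded'' and ''unshaded''. This gives two checkerboard graphs: the shaded checkerboard graph has vertices corresponding to the shaded regions, the unshaded checkerboard graph has vertices corresponding to the unshaded regions. In both graphs the edges correspond to the crossings: the edge of a crossing joins the two regions of the given color incident at the crossing (a loop if they coincide). Edge signs: At a crossing drawn so that the shaded regions are at the top and bottom and the unshaded regions at the left and right, the corresponding edge of the unshaded checkerboard graph has sign $-1$ if the overpassing segment runs from upper left to lower right, and sign $+1$ if the overpassing segment runs from lower left to upper right. Each edge of the shaded checkerboard graph has the sign opposite to that of the edge of the unshaded graph corresponding to the same crossing. (Consequently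 reversing the 2-coloring merely interchanges the two signed checkerboard graphs.) A 2-isomorphism between graphs $G$ and $H$ is a bijection $E(G)\leftrightarrow E(H)$ under which edge sets of maximal forests of $G$ correspond to edge sets of maximal forests of $H$. An isomorphism (resp. 2-isomorphism) of signed graphs $G$ and $H$ is an isomorphism (resp. 2-isomorphism) $f$ between the unsigned versions of $G$ and $H$ such that for every $e\in E(G)$, $e$ and $f(e)$ have the same sign. *)

(* Defs.v *)
From Stdlib Require Export Relation_Definitions Relation_Operators.
From HB Require Import structures.
From mathcomp Require Export all_boot.

Set Implicit Arguments.
Unset Strict Implicit.
Unset Printing Implicit Defensive.

(* Loops are the edges with a single end. *)
Record graph := Graph {
  vertex : finType;
  edge : finType;
  ends : edge -> {set vertex};
  card_ends : forall e, 0 < #|ends e| <= 2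
}.

(* [true] is the sign +1 and [false] the sign -1. *)
Record sgraph := SGraph {
  underlying :> graph;
  sign : edge underlying -> bool
}.

Definition adjacent (G : graph) : rel (vertex G) :=
  fun x y => [exists e, ends e == [set x; y]].

(* The graph without vertices is not connected. *)
Definition connected (G : graph) : Prop :=
  0 < #|vertex G| /\ forall x y : vertex G, connect (@adjacent G) x y.

(* The cycle x_0 -e_0- x_1 -e_1- ... -e_(k-1)- x_0 is given as the sequence of
   pairs (x_i, e_i); k = 1 is a loop, k = 2 a pair of parallel edges. *)
Definition graph_cycle (G : graph) (c : seq (vertex G * edge G)) : bool :=
  [&& c != [::], uniq (unzip1 c), uniq (unzip2 c) &
      cycle (fun p q => ends p.2 == [set p.1; q.1]) c].

Definition forest (G : graph) (F : {set edge G}) : Prop :=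
  forall c : seq (vertex G * edge G),
    graph_cycle c -> ~ {subset unzip2 c <= F}.

Definition maximal_forest (G : graph) (F : {set edge G}) : Prop :=
  forest F /\ forall F' : {set edge G}, F \subset F' -> forest F' -> F' = F.

Definition graph_isomorphism (G H : graph)
    (fV : vertex G -> vertex H) (fE : edge G -> edge H) : Prop :=
  [/\ bijective fV, bijective fE & forall e, ends (fE e) = fV @: ends e].

Definition two_isomorphism (G H : graph) (f : edge G -> edge H) : Prop :=
  bijective f /\
  forall F : {set edge G}, maximal_forest F <-> maximal_forest (f @: F).

Definition signed_isomorphic (G H : sgraph) : Prop :=
  exists fV (fE : edge G -> edge H),
    graph_isomorphism fV fE /\ forall e, sign (fE e) = sign e.

Definition signed_two_isomorphic (G H : sgraph) : Prop :=
  exists f : edge G -> edge H,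
    two_isomorphism f /\ forall e, sign (f e) = sign e.

(* The half-edge (c, i) is the i-th of the four ends of arcs at the crossing c,
   in counterclockwise order as seen by the observer, the overpassing segment
   consisting of the half-edges 0 and 2.  The same pair also names the corner
   (c, i), i.e. the sector at c between the half-edges (c, i) and (c, i + 1). *)
Definition half_edge (X : finType) : finType := (X * 'I_4)%type.

Definition next_ccw (X : finType) (h : half_edge X) : half_edge X :=
  (h.1, ordS h.2).

Definition next_cw (X : finType) (h : half_edge X) : half_edge X :=
  (h.1, ord_pred h.2).

(* Link diagrams up to orientation-preserving homeomorphism of the plane,
   possibly disconnected, with crossingless components, or empty.
   - An arc is a pair {h, opp h}.  A circle is a component without crossings;
     [side k true] and [side k false] are the regions on its two sides.
   - [corner h] is the region containing the corner h.  Following the arc of h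
     away from its crossing with that region on the left, the next corner of
     the region is next_cw (opp h).  So the boundary curves of the regions are
     the orbits of next_cw \o opp and the two sides of each circle.
   - Gluing to the arcs and circles, for each region, a sphere with one hole for
     each boundary curve of the region yields a closed oriented surface.  It is
     connected if and only if one can go from any region to any other across
     arcs and circles.  A region with b boundary curves has Euler
     characteristic 2 - b, so that of the surface is V - E + 2 R - B where
     V = #|crossing|, E = 2 V is the number of arcs, R = #|region| and B is the
     number of boundary curves (a circle adds as many vertices as edges).  The surface has to be a sphere, which is to say
     that it is connected with V - E + 2 R - B = 2. *)
Record link_diagram := LinkDiagram {
  crossing : finType;
  circle : finType;
  region : finType;
  opp : half_edge crossing -> half_edge crossing;
  corner : half_edge crossing -> region;
  side : circle -> bool -> region;
  unbounded : region;
  opp_involutive : involutive opp;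
  opp_neq : forall h, opp h != h;
  corner_next : forall h, corner (next_cw (opp h)) = corner h;
  region_connected : forall r r' : region,
    connect (fun r1 r2 =>
      [exists h, (corner h == r1) && (corner (next_ccw h) == r2)]
      || [exists k, exists b, (side k b == r1) && (side k (~~ b) == r2)]) r r';
  euler_sphere :
    #|crossing| + 2 * #|region| =
    2 + 2 * #|crossing|
      + (fcard (@next_cw crossing \o opp) predT + 2 * #|circle|)
}.

(* [true] is shaded. *)
Record coloring (D : link_diagram) := Coloring {
  shade :> region D -> bool;
  shade_corner : forall h, shade (corner h) != shade (corner (next_ccw h));
  shade_side : forall k, shade (side k true) != shade (side k false)
}.

Section CheckerboardGraph.

Context (D : link_diagram) (s : coloring D) (b : bool).

Definition colored_region : finType := {r : region D | s r == b}.

Definition crossing_ends (c : crossing D) : {set colored_region} :=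
  [set r | [exists i : 'I_4, corner (c, i) == val r]].

Lemma card_crossing_ends c : 0 < #|crossing_ends c| <= 2.
Proof.
pose o i : 'I_4 := inord i; pose k i := corner (c, o i).
have oS i : i < 3 -> ordS (o i) = o i.+1.
  by move=> lti; apply/val_inj; rewrite /= !inordK ?modn_small // ltnW.
have kS i : i < 3 -> s (k i.+1) = ~~ s (k i).
  move=> lti; have := shade_corner s (c, o i); rewrite /next_ccw /= oS // -/(k i).
  by rewrite -/(k i.+1); case: (s (k i)); case: (s _).
have kE (i : 'I_4) : corner (c, i) = k i by rewrite /k /o inord_val.
have [j [ltj skj skj2 nj]] : exists j, [/\ j < 2, s (k j) == b, s (k j.+2) == b &
    forall i, i < 4 -> s (k i) == b -> i = j \/ i = j.+2].
  have := kS 2 isT; have := kS 1 isT; have := kS 0 isT.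
  case s0: (s (k 0)) => s1; rewrite s1 => s2; rewrite s2 => s3 /=;
    rewrite /= in s1 s2 s3; exists (s (k 0) != b); rewrite s0; case: b => /=;
    rewrite ?s0 ?s1 ?s2 ?s3; split=> //; move=> [|[|[|[|i]]]] //=;
    rewrite ?s0 ?s1 ?s2 ?s3 //; by auto.
pose u : colored_region := Sub (k j) skj; pose v : colored_region := Sub (k j.+2) skj2.
apply/andP; split.
  by apply/card_gt0P; exists u; rewrite inE; apply/existsP; exists (o j).
apply: leq_trans (_ : #|[set u; v]| <= 2); last by rewrite cards2; case: (_ != _).
apply/subset_leq_card/subsetP => r; rewrite !inE => /existsP[i].
rewrite kE => /eqP kir; rewrite -!val_eqE /= -kir.
have ski : s (k i) == b by rewrite kir; exact: (valP r).
by case: (nj i (ltn_ord i) ski) => ->; rewrite eqxx ?orbT.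
Qed.

(* Since the half-edge (c, 0) is overpassing, turning the overpassing segment
   counterclockwise sweeps the corners (c, 0) and (c, 2).  If shaded regions are
   at the top and bottom, these corners are shaded if that segment runs from
   lower left to upper right, and unshaded if it runs from upper left to lower
   right.  So s (corner (c, ord0)) is the sign in the unshaded graph. *)
Definition crossing_sign (c : crossing D) : bool :=
  if b then ~~ s (corner (c, ord0)) else s (corner (c, ord0)).

(* The shaded graph if b = true, the unshaded one if b = false. *)
Definition checkerboard_graph : sgraph :=
  @SGraph (Graph card_crossing_ends) crossing_sign.

End CheckerboardGraph.

Definition checkerboard_connected (D : link_diagram) : Prop :=
  exists s : coloring D, forall b, connected (checkerboard_graph s b).

Definition connected_diagram : Type := {D | checkerboard_connected D}.

Definition share_checkerboard (P : sgraph -> sgraph -> Prop) :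
    relation connected_diagram :=
  fun D D' => exists (s : coloring (sval D)) b (s' : coloring (sval D')) b',
    P (checkerboard_graph s b) (checkerboard_graph s' b').

Definition equiv1 : relation connected_diagram :=
  clos_refl_sym_trans _ (share_checkerboard signed_isomorphic).

Definition equiv2 : relation connected_diagram :=
  clos_refl_sym_trans _ (share_checkerboard signed_two_isomorphic).

(* Main.v *)
Require Import Defs.
From mathcomp Require Import ssralg zmodp matrix mxalgebra zify.

Set Implicit Arguments.
Unset Strict Implicit.
Unset Printing Implicit Defensive.

(** An isomorphism preserves forests, so one direction is immediate. For the other one, let G
and K be the checkerboard graphs of a diagram, considered as graphs on the set X of crossings.
The idea is that G and K can be replaced independently of each other: if the diagram with the
graphs G' and K' has a 2-isomorphic G' on the same X, then there should be a diagram with the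
graphs G and K', which shares one graph with each of the two given diagrams.

Over the field with two elements the cut spaces of G and K are orthogonal complements. They are
orthogonal because both halves of an arc separate the same two regions ([region_orthogonal]),
and the Euler formula supplies the dimensions ([region_count], [euler_cut]). A 2-isomorphism
preserves the cut space, because a set of edges is a forest if and only if it contains no
nonempty even set ([forestP], [even_set_image]). Therefore the cut spaces of G and K' are
orthogonal complements as well.

When do two such graphs on X come from a diagram? Make each crossing a quadrilateral whose
corners are alternately its ends in the two graphs. Orthogonality implies that an even number of
sides runs between any vertex of one graph and any vertex of the other, so the quadrilaterals
can be glued along their sides. Assume that the quadrilaterals are linked with each other by
sides that may be glued; with duality this is what [planar_pair] requires. Then a gluing with
the fewest possible cycles around the vertices has a single cycle around each vertex of both
graphs: otherwise two pairs of sides could be reglued so that two cycles merge and no cycle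
breaks ([merge_cycles], [planar_star_connected]). The result is a closed surface. It is
orientable since the edges where local orientations disagree form a cut
([planar_orientation]), and its Euler characteristic is 2 because the cut spaces are
complements. So every planar pair is realized by a diagram ([realization]), and conversely the
checkerboard graphs of a diagram form a planar pair ([diagram_planar]).

It remains to treat the case that G and K' are not linked. A linked part of the crossings is then
a union of components of the matroid. A planar pair whose matroid is disconnected is a sum of
two smaller pairs, attached to each other at a vertex and a face ([planar_split]); this is a
connected sum of diagrams. The place of attachment may be moved: replacing the vertex changes
only one of the two graphs, and replacing the face only the other one ([attach_walk]). In this way
both diagrams can be changed, by steps that keep one of the two graphs, into sums along the same
separation of X ([planar_decompose]), and induction on the number of crossings applies to the
summands ([same_cuts_reach]). *)

(** * Parity sums *)

(** The values cancel in pairs; of each pair [h], [t h] the sum is split at the one that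
   comes first in the enumeration. *)
Lemma xor_invariant (T : finType) (t : T -> T) (P : pred T) (F : T -> bool) :
  involutive t -> (forall h, P h -> t h != h) -> (forall h, P (t h) = P h) ->
  (forall h, P h -> F (t h) = F h) ->
  \big[addb/false]_(h | P h) F h = false.
Proof.
move=> tK tN tP tF.
pose r (h : T) := enum_rank h < enum_rank (t h).
rewrite (bigID r) /= [X in _ (+) X](reindex_inj (inv_inj tK)) /=.
set a := bigop _ _ _; suff -> : a = \big[addb/false]_(j | P (t j) && ~~ r (t j)) F (t j).
  exact: addbb.
apply: eq_big => h; last by case/andP=> /tF.
rewrite tP; case Ph: (P h) => //=; rewrite /r tK -leqNgt ltn_neqAle.
suff -> : nat_of_ord (enum_rank h) != enum_rank (t h) by [].
by rewrite (inj_eq val_inj) (inj_eq enum_rank_inj) eq_sym tN.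
Qed.

Lemma xor_card (T : finType) (P : pred T) :
  \big[addb/false]_(h | P h) true = odd #|P|.
Proof. by rewrite big_const; elim: #|_| => //= n ->; case: odd. Qed.

(** Pairs the positions 0 and 1, 2 and 3, and so on. *)
Definition flip_last_bit n := if odd n then n.-1 else n.+1.

Lemma flip_last_bitK : involutive flip_last_bit.
Proof. by move=> n; rewrite /flip_last_bit; case: (boolP (odd n)) => n2; case: ifP; lia. Qed.

(** Classes of even size can be cut up into pairs. *)
Lemma paired (T : finType) (L : eqType) (l : T -> L) (A : pred T) :
  (forall h, A h -> ~~ odd #|[pred h' | A h' & l h' == l h]|) ->
  exists t : T -> T, [/\ involutive t, forall h, A h -> t h != h,
    forall h, A (t h) = A h & forall h, l (t h) = l h].
Proof.
move=> evn.
pose C h := [pred h' | A h' & l h' == l h].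
pose t h := if A h then nth h (enum (C h)) (flip_last_bit (index h (enum (C h))))
            else h.
have memC h : A h -> h \in enum (C h) by move=> Ah; rewrite mem_enum inE /= Ah eqxx.
have ltC h : A h -> flip_last_bit (index h (enum (C h))) < size (enum (C h)).
  move=> Ah; have := memC _ Ah; rewrite -index_mem.
  have : ~~ odd (size (enum (C h))) by rewrite -cardE; apply: evn.
  move: (size _) (index _ _) => n i; rewrite /flip_last_bit.
  by case: (boolP (odd i)); lia.
have tC h : A h -> t h \in C h.
  by move=> Ah; rewrite -mem_enum /t Ah mem_nth ?ltC.
have tA h : A h -> A (t h) by move/tC; rewrite inE => /andP[].
have tl h : l (t h) = l h.
  case Ah: (A h); last by rewrite /t Ah.
  by have := tC _ Ah; rewrite inE => /andP[_ /eqP].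
have CE h : enum (C (t h)) = enum (C h) by apply: eq_enum => u; rewrite !inE tl.
have tK : involutive t.
  move=> h; case Ah: (A h); last by rewrite /t Ah Ah.
  rewrite {1}/t tA // CE {2}/t Ah index_uniq ?enum_uniq ?ltC //.
  rewrite (set_nth_default h) ?index_mem ?memC //.
    rewrite -[X in _ = X](nth_index h (memC _ Ah)); congr nth.
    by rewrite flip_last_bitK.
  by rewrite flip_last_bitK index_mem memC.
exists t; split => // h.
  move=> Ah; rewrite /t Ah -[X in _ == X](nth_index h (memC _ Ah)) nth_uniq ?enum_uniq ?ltC //.
    by rewrite /flip_last_bit; case: (boolP (odd _)); lia.
  by rewrite index_mem memC.
apply/idP/idP => [|/tA//]; case Ah: (A h) => //.
by rewrite /t Ah Ah.
Qed.

(** * Planar pairs of graphs *)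

Section Labelings.

Variable X : finType.

(** A graph with edge set [X] is given by the labels of the two ends of each edge, so that a
   vertex is a label in use. All notions are relative to a set [A] of active edges, which lets
   a part of a graph be studied without changing types; isolated vertices do not arise. *)
Definition labeling := X -> bool -> nat.

Implicit Types (g k : labeling) (A B C S : {set X}) (u w : X -> bool) (q r : nat -> bool).

(** The cut between the vertices in [q] and the others; loops are in no cut. *)
Definition coboundary g q (e : X) : bool := q (g e false) (+) q (g e true).

Definition dot A u w := \big[addb/false]_(e in A) (u e && w e).

Definition cut A g w := exists q, forall e, e \in A -> w e = coboundary g q e.

Definition orthogonal A g w := forall q, dot A w (coboundary g q) = false.

(** The cut spaces are orthogonal complements, that is, the cycle matroids of the two graphs
   are dual to each other. *)
Definition abstract_dual A g k :=
  [/\ forall q, orthogonal A k (coboundary g q),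
      forall w, orthogonal A k w -> cut A g w
    & forall w, orthogonal A g w -> cut A k w].

(** Each edge [e] is a quadrilateral with corners [g e false], [k e false], [g e true],
   [k e true]; two quadrilaterals touch when they could be glued along a side. *)
Definition touch g k : rel X := fun e e' =>
  [exists s : bool * bool, exists s' : bool * bool,
     (g e s.1 == g e' s'.1) && (k e s.2 == k e' s'.2)].

Definition touch_in A g k : rel X :=
  fun e e' => [&& e \in A, e' \in A & touch g k e e'].

Definition linked A g k :=
  [forall e in A, forall e' in A, connect (touch_in A g k) e e'].

(** These are the pairs of checkerboard graphs of diagrams. For dual matroids being linked is
   more than connectedness of both graphs: the blocks of the graphs also have to be attached
   to each other at a common vertex and a common face. *)
Record planar_pair A g k : Prop := PlanarPair {
  planar_dual : abstract_dual A g k;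
  planar_linked : linked A g k
}.

Lemma touchP g k e e' :
  reflect (exists x y x' y', g e x = g e' x' /\ k e y = k e' y') (touch g k e e').
Proof.
apply: (iffP existsP) => [[[x y] /existsP[[x' y'] /= /andP[/eqP a /eqP b]]]|].
  by exists x, y, x', y'.
case=> x [y [x' [y' [a b]]]]; exists (x, y); apply/existsP; exists (x', y').
by rewrite /= a b !eqxx.
Qed.

Lemma touch_sym g k : symmetric (touch g k).
Proof.
move=> e e'; apply/touchP/touchP => -[x [y [x' [y' [a b]]]]];
  by exists x', y', x, y.
Qed.

Lemma touchC g k : touch g k =2 touch k g.
Proof.
move=> e e'; apply/touchP/touchP => -[x [y [x' [y' [a b]]]]];
  by exists y, x, y', x'.
Qed.

Lemma touch_in_connect_sym A g k : connect_sym (touch_in A g k).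
Proof.
apply: sym_connect_sym => e e'; rewrite /touch_in touch_sym.
by case: (e \in A); case: (e' \in A).
Qed.

Lemma linkedC A g k : linked A g k = linked A k g.
Proof.
rewrite /linked; apply: eq_forallb => e; congr (_ ==> _); apply: eq_forallb => e'; congr (_ ==> _).
by apply: eq_connect => a b; rewrite /touch_in touchC.
Qed.

Lemma linked_ind A g k (P : X -> Prop) :
  linked A g k ->
  (forall e e', e \in A -> e' \in A -> touch g k e e' -> P e -> P e') ->
  forall e e', e \in A -> e' \in A -> P e -> P e'.
Proof.
move=> /forall_inP lk IH e e' eA e'A.
have /forall_inP/(_ _ e'A)/connectP[p] := lk _ eA.
elim: p e eA => [|a p IHp] e eA /= => [_ -> //|/andP[/and3P[_ aA t] pp] el Pe].
exact: IHp aA pp el (IH _ _ eA aA t Pe).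
Qed.

Lemma linked_closed A g k :
  (forall C : {set X}, C \subset A -> C != set0 ->
     (forall e e', e \in C -> e' \in A -> touch g k e e' -> e' \in C) -> C = A) ->
  linked A g k.
Proof.
move=> cl; apply/forall_inP=> e eA; apply/forall_inP=> e' e'A.
pose C := [set a in A | connect (touch_in A g k) e a].
suff CA : C = A by have := e'A; rewrite -{1}CA inE => /andP[].
apply: cl.
- by apply/subsetP=> a; rewrite inE => /andP[].
- by apply/set0Pn; exists e; rewrite inE eA connect0.
- move=> a b; rewrite !inE => /andP[aA ea] bA t; rewrite bA /=.
  by apply: connect_trans ea (connect1 _); rewrite /touch_in aA bA.
Qed.

Lemma unlinked_part A g k : ~~ linked A g k ->
  exists C, [/\ C \subset A, C != set0, C != A &
    forall e e', e \in C -> e' \in A -> touch g k e e' -> e' \in C].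
Proof.
rewrite negb_forall_in => /exists_inP[e eA]; rewrite negb_forall_in => /exists_inP[e' e'A nc].
exists [set a in A | connect (touch_in A g k) e a]; split.
- by apply/subsetP=> a; rewrite inE => /andP[].
- by apply/set0Pn; exists e; rewrite inE eA connect0.
- by apply: contra nc => /eqP/setP/(_ e'); rewrite inE e'A.
- move=> a b; rewrite !inE => /andP[aA ea] bA t; rewrite bA /=.
  by apply: connect_trans ea (connect1 _); rewrite /touch_in aA bA.
Qed.

(** The component is linked by touches inside itself, so it can be taken as the set of active
   edges. *)
Lemma linked_component A g k e : e \in A ->
  exists C, [/\ C \subset A, e \in C, linked C g k &
    forall e1 e2, e1 \in C -> e2 \in A -> touch g k e1 e2 -> e2 \in C].
Proof.
move=> eA; set C := [set a in A | connect (touch_in A g k) e a].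
have CE a : (a \in C) = (a \in A) && connect (touch_in A g k) e a by rewrite inE.
have clC e1 e2 : e1 \in C -> e2 \in A -> touch g k e1 e2 -> e2 \in C.
  rewrite !CE => /andP[e1A ee1] e2A t; rewrite e2A /=.
  by apply: connect_trans ee1 (connect1 _); rewrite /touch_in e1A e2A.
have eC : e \in C by rewrite CE eA connect0.
exists C; split => //; first by apply/subsetP=> a; rewrite inE => /andP[].
have H a : a \in C -> connect (touch_in C g k) e a.
  rewrite CE => /andP[_ /connectP[p]]; elim/last_ind: p a => [|p b IHp] a /=.
    by move=> _ ->; apply: connect0.
  rewrite rcons_path last_rcons => /andP[pp /and3P[lA bA t]] ->.
  apply: connect_trans (IHp _ pp erefl) (connect1 _).
  have lC : last e p \in C by rewrite CE lA; apply/connectP; exists p.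
  by rewrite /touch_in lC (clC _ _ lC bA t) t.
apply/forall_inP=> a aC; apply/forall_inP=> b bC.
by apply: connect_trans (H _ bC); rewrite touch_in_connect_sym H.
Qed.

Lemma dotC A u w : dot A u w = dot A w u.
Proof. by apply: eq_bigr => e _; rewrite andbC. Qed.

Lemma eq_dot A u u' w w' :
  (forall e, e \in A -> u e = u' e) -> (forall e, e \in A -> w e = w' e) ->
  dot A u w = dot A u' w'.
Proof. by move=> uu ww; apply: eq_bigr => e eA; rewrite uu ?ww. Qed.

Lemma dot_restrict A B u w : B \subset A ->
  dot A (fun e => (e \in B) && u e) w = dot B u w.
Proof.
move=> sBA; rewrite /dot (big_setID B) /= (setIidPr sBA) [X in _ (+) X]big1 ?addbF.
  by apply: eq_bigr => e ->.
by move=> e; rewrite inE => /andP[/negPf->].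
Qed.

Lemma dotU A B u w : [disjoint A & B] -> dot (A :|: B) u w = dot A u w (+) dot B u w.
Proof. by move=> dAB; rewrite /dot -bigU //; apply: eq_bigl => e; rewrite !inE. Qed.

Lemma abstract_dualC A g k : abstract_dual A g k -> abstract_dual A k g.
Proof. by case=> o d d'; split => // q q'; rewrite dotC; apply: o. Qed.

Lemma planar_pairC A g k : planar_pair A g k -> planar_pair A k g.
Proof. by case=> d l; split; [exact: abstract_dualC|rewrite linkedC]. Qed.

Lemma cut_orthogonal A g k w : abstract_dual A g k -> cut A g w -> orthogonal A k w.
Proof. by case=> o _ _ [q wq] r; rewrite -(o q r); apply: eq_dot. Qed.

Lemma cut_restrict A B g w : B \subset A -> cut A g w -> cut B g w.
Proof. by move=> /subsetP s [q wq]; exists q => e /s/wq. Qed.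

(** The labelings give the same graph, with the same names for edge ends. *)
Definition same_on A g g' :=
  forall e x e' x', e \in A -> e' \in A -> (g e x == g e' x') = (g' e x == g' e' x').

Lemma same_on_sym A g g' : same_on A g g' -> same_on A g' g.
Proof. by move=> s e x e' x' eA e'A; rewrite (s e x e' x'). Qed.

Lemma same_on_trans A g1 g2 g3 : same_on A g1 g2 -> same_on A g2 g3 -> same_on A g1 g3.
Proof. by move=> s s' e x e' x' eA e'A; rewrite (s e x e' x') // (s' e x e' x'). Qed.

Lemma same_on_pull A g g' q : same_on A g g' ->
  exists q', forall e x, e \in A -> q' (g' e x) = q (g e x).
Proof.
move=> s; exists (fun n => [exists h : X * bool, [&& h.1 \in A, g' h.1 h.2 == n & q (g h.1 h.2)]]).
move=> e x eA; apply/existsP/idP => [[[e' x'] /= /and3P[e'A]]|qe].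
  by rewrite -(s e' x' e x) // => /eqP ->.
by exists (e, x); rewrite /= eA eqxx.
Qed.

Lemma same_on_coboundary A g g' q : same_on A g g' -> cut A g' (coboundary g q).
Proof.
move=> /(same_on_pull q) [q' qq']; exists q' => e eA.
by rewrite /coboundary !qq'.
Qed.

Lemma same_on_cut A g g' w : same_on A g g' -> cut A g w -> cut A g' w.
Proof.
move=> s [q wq]; have [q' qq'] := same_on_coboundary q s.
by exists q' => e eA; rewrite wq ?qq'.
Qed.

Lemma orthogonal_cut A g w w' : orthogonal A g w -> cut A g w' -> dot A w w' = false.
Proof. by move=> o [q wq]; rewrite -(o q); apply: eq_dot. Qed.

Lemma same_on_orthogonal A g g' w : same_on A g g' -> orthogonal A g w -> orthogonal A g' w.
Proof.
move=> /same_on_sym s o q; apply: (orthogonal_cut o).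
exact: same_on_coboundary s.
Qed.

Lemma same_on_touch A g g' k k' e e' : same_on A g g' -> same_on A k k' ->
  e \in A -> e' \in A -> touch g k e e' = touch g' k' e e'.
Proof.
move=> s s' eA e'A; apply: eq_existsb => a; apply: eq_existsb => b.
by rewrite (s e _ e') // (s' e _ e').
Qed.

Lemma same_on_linked A g g' k k' : same_on A g g' -> same_on A k k' ->
  linked A g k = linked A g' k'.
Proof.
move=> s s'; rewrite /linked; apply: eq_forallb => e; congr (_ ==> _); apply: eq_forallb => e'; congr (_ ==> _).
apply: eq_connect => a b; rewrite /touch_in.
by case aA: (a \in A); case bA: (b \in A) => //=; rewrite (same_on_touch s s').
Qed.

Lemma same_on_planar A g g' k k' : same_on A g g' -> same_on A k k' ->
  planar_pair A g k -> planar_pair A g' k'.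
Proof.
move=> s s' [[o d d'] l]; split; last by rewrite -(same_on_linked s s').
split=> [q|w ow|w ow].
- apply: (same_on_orthogonal s') => r.
  rewrite dotC; apply: (@orthogonal_cut A g); first by move=> q'; rewrite dotC; apply: o.
  by apply: same_on_coboundary (same_on_sym s).
- by apply: (same_on_cut s); apply: d; apply: same_on_orthogonal (same_on_sym s') _.
- by apply: (same_on_cut s'); apply: d'; apply: same_on_orthogonal (same_on_sym s) _.
Qed.

(** * Sides of the quadrilaterals *)

(** The side of the quadrilateral [e] between the corners [g e x] and [k e y] is [(e, x, y)]. *)
Definition quad_side := (X * bool * bool)%type.

Lemma dot_coboundary A (C : {set X}) g k q r : C \subset A ->
  dot A (fun e => (e \in C) && coboundary g q e) (coboundary k r) =
  \big[addb/false]_(h : quad_side | h.1.1 \in C) (q (g h.1.1 h.1.2) && r (k h.1.1 h.2)).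
Proof.
move=> s; rewrite dot_restrict //; transitivity (\big[addb/false]_(e in C)
  \big[addb/false]_(x : bool) \big[addb/false]_(y : bool) (q (g e x) && r (k e y))).
  apply: eq_bigr => e _; rewrite !big_bool /coboundary.
  by case: (q _); case: (q _); case: (r _); case: (r _).
by rewrite pair_big /= pair_big /=; apply: eq_bigl => h; rewrite !andbT.
Qed.

(** For a vertex and a face, orthogonality of their stars says that an even number of sides
   carries both labels; so the sides can be glued in pairs. *)
Lemma side_pairing A g k : (forall q, orthogonal A k (coboundary g q)) ->
  exists t : quad_side -> quad_side,
    [/\ involutive t, forall h, h.1.1 \in A -> t h != h,
        forall h, ((t h).1.1 \in A) = (h.1.1 \in A),
        forall h, g (t h).1.1 (t h).1.2 = g h.1.1 h.1.2
      & forall h, k (t h).1.1 (t h).2 = k h.1.1 h.2].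
Proof.
move=> o; have [h hA|t [tK tN tA tl]] := @paired quad_side _
  (fun h => (g h.1.1 h.1.2, k h.1.1 h.2)) (fun h => h.1.1 \in A).
  have := o (pred1 (g h.1.1 h.1.2)) (pred1 (k h.1.1 h.2)).
  rewrite (@eq_dot _ _ (fun e => (e \in A) && coboundary g (pred1 (g h.1.1 h.1.2)) e) _
    (coboundary k (pred1 (k h.1.1 h.2)))) //; last by move=> e ->.
  rewrite dot_coboundary // => {}o; apply: negbT; rewrite -{}o -xor_card [LHS]big_mkcondr.
  by apply: eq_bigr => h' _ /=; rewrite xpair_eqE; case: ifP.
exists t; split=> // h; by have [] := tl h.
Qed.

(** * Separators *)

(** In terms of matroids, [S] meets [A] in a union of components. *)
Definition separator A g S := forall q, cut A g (fun e => (e \in S) && coboundary g q e).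

(** Extension by zero takes vectors orthogonal on [C] to vectors orthogonal on [A]. *)
Lemma dual_part A g k C : abstract_dual A g k -> C \subset A ->
  separator A g C -> abstract_dual C g k.
Proof.
move=> dl s sp; have [o d d'] := dl; split=> [q r|w ow|w ow].
- by rewrite -(dot_restrict _ _ s); apply: cut_orthogonal dl _ _.
- have /(cut_restrict s) [q wq] : cut A g (fun e => (e \in C) && w e).
    by apply: d => q; rewrite dot_restrict.
  by exists q => e eC; rewrite -wq // eC.
- have /(cut_restrict s) [q wq] : cut A k (fun e => (e \in C) && w e).
    by apply: d' => q; rewrite dot_restrict.
  by exists q => e eC; rewrite -wq // eC.
Qed.

(** A side in [C] is glued to a side in [C], so the sides in [C] alone already have
   the parities that give orthogonality. *)
Lemma touch_closed_separator A g k S C : abstract_dual A g k -> S \subset A ->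
  separator A g S -> C \subset S ->
  (forall e e', e \in C -> e' \in S -> touch g k e e' -> e' \in C) ->
  separator A g C.
Proof.
move=> dl sSA sp sCS cl; have [_ d _] := dl => q; apply: d => r.
have [o _ _] := dual_part dl sSA sp.
rewrite dot_coboundary ?(subset_trans sCS) //.
have [t [tK tN tS tg tk]] := side_pairing o.
apply: (xor_invariant tK).
- by move=> h /(subsetP sCS)/tN.
- move=> h; have tchs (h' : quad_side) : h'.1.1 \in C -> (t h').1.1 \in C.
    move=> h'C; apply: (cl _ _ h'C); first by rewrite tS (subsetP sCS).
    by apply/touchP; exists h'.1.2, h'.2, (t h').1.2, (t h').2; rewrite tg tk.
  by apply/idP/idP => /tchs; rewrite ?tK.
- by move=> h _; rewrite tg tk.
Qed.

Lemma separatorT A g : separator A g A.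
Proof. by move=> q; exists q => e ->. Qed.

Lemma separatorD A g S : separator A g S -> separator A g (A :\: S).
Proof.
move=> sp q; have [q' qq'] := sp q; exists (fun n => q n (+) q' n) => e eA.
have := qq' e eA; rewrite inE eA andbT /coboundary.
by case: (e \in S); case: (q _); case: (q _); case: (q' _); case: (q' _).
Qed.

Lemma separatorU A g S S' : S' \subset A :\: S ->
  separator A g S -> separator A g S' -> separator A g (S :|: S').
Proof.
move=> /subsetP dS sp sp' q; have [q1 qq1] := sp q; have [q2 qq2] := sp' q.
exists (fun n => q1 n (+) q2 n) => e eA.
rewrite inE /coboundary addbACA -[X in _ = X (+) _]/(coboundary g q1 e).
rewrite -[X in _ = _ (+) X]/(coboundary g q2 e) -(qq1 e eA) -(qq2 e eA) /coboundary.
have := dS e; rewrite inE eA.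
by case: (e \in S); case: (e \in S') => //= d; rewrite ?addbF //; have := d isT.
Qed.

Lemma separatorS A B g S : B \subset A -> separator A g S -> separator B g S.
Proof. by move=> s sp q; apply: cut_restrict s (sp q). Qed.

End Labelings.

(** * Sums of planar pairs *)

Section Sums.

Variable X : finType.

Implicit Types (g k : labeling X) (A B C S : {set X}) (u w : X -> bool) (q r : nat -> bool).

(** The graphs are joined at their vertices 0. The other vertices of the first graph become
   even labels, those of the second graph odd ones. *)
Definition sum_label A g1 g2 : labeling X :=
  fun e x => if e \in A then (g1 e x).*2 else (g2 e x).*2.-1.

Lemma eq_double m n : (m.*2 == n.*2) = (m == n). Proof. lia. Qed.

Lemma eq_double_pred m n : (m.*2.-1 == n.*2.-1) = (m == n). Proof. lia. Qed.

Lemma eq_double_double_pred m n : (m.*2 == n.*2.-1) = (m == 0) && (n == 0). Proof. lia. Qed.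

(** Some quadrilateral has both roots as corners, so the roots of two such pairs can be
   identified in the plane. *)
Definition rooted A g k := A = set0 \/
  exists e x y, [/\ e \in A, g e x = 0 & k e y = 0].

(** A function on the vertices of one summand is extended to the other one by its value at
   the root, where it has no cut; the functions found on both sides agree at the root after
   adding a constant to one of them. *)
Lemma sum_label_dual A B g1 k1 g2 k2 w : [disjoint A & B] ->
  (forall w, orthogonal A k1 w -> cut A g1 w) ->
  (forall w, orthogonal B k2 w -> cut B g2 w) ->
  orthogonal (A :|: B) (sum_label A k1 k2) w -> cut (A :|: B) (sum_label A g1 g2) w.
Proof.
move=> dAB d1 d2 o.
have nA e : e \in B -> (e \in A) = false.
  by move=> eB; apply: contraTF eB => /(disjointFr dAB) ->.
have [q1 w1] : cut A g1 w.
  apply: d1 => r; have := o (fun n => r (if odd n then 0 else n./2)).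
  rewrite dotU // [X in _ (+) X]big1 ?addbF => [|e eB].
    move=> <-; apply: eq_dot => // e eA.
    by rewrite /coboundary /sum_label eA !odd_double !doubleK.
  rewrite /coboundary /sum_label nA //.
  by case: (k2 e false) => [|n]; case: (k2 e true) => [|m] //=; rewrite ?odd_double ?addbb ?andbF.
have [q2 w2] : cut B g2 w.
  apply: d2 => r; have := o (fun n => r (if odd n then n.+1./2 else 0)).
  rewrite dotU // [X in X (+) _]big1 => [|e eA].
    rewrite addFb => <-; apply: eq_dot => // e eB.
    rewrite /coboundary /sum_label nA //.
    by case: (k2 e false) => [|n]; case: (k2 e true) => [|m] //=; rewrite ?odd_double /= ?doubleK.
  by rewrite /coboundary /sum_label eA !odd_double addbb andbF.
exists (fun n => if odd n then q2 n.+1./2 (+) q2 0 (+) q1 0 else q1 n./2) => e.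
rewrite inE => /orP[eA|eB]; rewrite /coboundary /sum_label.
  by rewrite eA !odd_double !doubleK w1.
rewrite nA // w2 // /coboundary.
case: (k2 e false) => [|n]; case: (g2 e false) => [|n']; case: (g2 e true) => [|m'] //=;
  rewrite ?odd_double /= ?doubleK ?addbb //;
  by case: (q2 0); case: (q1 0); case: (q2 _) => //; case: (q2 _).
Qed.

Lemma sum_orthogonal A B g1 k1 g2 k2 q : [disjoint A & B] ->
  (forall q, orthogonal A k1 (coboundary g1 q)) ->
  (forall q, orthogonal B k2 (coboundary g2 q)) ->
  orthogonal (A :|: B) (sum_label A k1 k2) (coboundary (sum_label A g1 g2) q).
Proof.
move=> dAB o1 o2 r; rewrite dotU //.
have nA e : e \in B -> (e \in A) = false.
  by move=> eB; apply: contraTF eB => /(disjointFr dAB) ->.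
have -> : dot A (coboundary (sum_label A g1 g2) q) (coboundary (sum_label A k1 k2) r) = false.
  rewrite -(o1 (fun n => q n.*2) (fun n => r n.*2)).
  by apply: eq_dot => e eA; rewrite /coboundary /sum_label eA.
rewrite addFb -(o2 (fun n => q n.*2.-1) (fun n => r n.*2.-1)).
by apply: eq_dot => e eB; rewrite /coboundary /sum_label nA.
Qed.

Lemma sum_same_onl A g1 g2 : same_on A g1 (sum_label A g1 g2).
Proof. by move=> e x e' x' eA e'A; rewrite /sum_label eA e'A; lia. Qed.

Lemma sum_same_onr A B g1 g2 : [disjoint A & B] -> same_on B g2 (sum_label A g1 g2).
Proof.
move=> dAB e x e' x' eB e'B; rewrite /sum_label.
by rewrite !(disjointFl dAB) //; lia.
Qed.

Lemma sum_planar A B g1 k1 g2 k2 : [disjoint A & B] ->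
  planar_pair A g1 k1 -> rooted A g1 k1 -> planar_pair B g2 k2 -> rooted B g2 k2 ->
  planar_pair (A :|: B) (sum_label A g1 g2) (sum_label A k1 k2) /\
  rooted (A :|: B) (sum_label A g1 g2) (sum_label A k1 k2).
Proof.
move=> dAB [[o1 d1 d1'] l1] r1 [[o2 d2 d2'] l2] r2.
split; [split; [split|]|].
- by move=> q; apply: sum_orthogonal.
- by move=> w; apply: sum_label_dual.
- by move=> w; apply: sum_label_dual.
- apply: linked_closed => C sC /set0Pn[e0 e0C] cl; apply/eqP; rewrite eqEsubset sC /=.
  have cA e e' : e \in C -> e \in A -> e' \in A -> e' \in C.
    move=> eC eA e'A; apply: (linked_ind (P := fun e => e \in C) l1) eA e'A eC.
    move=> a b aA bA t aC; apply: cl aC _ _; first by rewrite inE bA.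
    by rewrite -(same_on_touch (@sum_same_onl A g1 g2) (@sum_same_onl A k1 k2)).
  have cB e e' : e \in C -> e \in B -> e' \in B -> e' \in C.
    move=> eC eB e'B; apply: (linked_ind (P := fun e => e \in C) l2) eB e'B eC.
    move=> a b aB bB t aC; apply: cl aC _ _; first by rewrite inE bB orbT.
    by rewrite -(same_on_touch (sum_same_onr g1 g2 dAB) (sum_same_onr k1 k2 dAB)).
  case: r1 => [A0|[a [x [y [aA ga ka]]]]].
    move: e0C (subsetP sC _ e0C); rewrite A0 set0U => e0C e0B.
    by apply/subsetP => e eB; apply: cB e0C e0B eB.
  case: r2 => [B0|[b [x' [y' [bB gb kb]]]]].
    move: e0C (subsetP sC _ e0C); rewrite B0 setU0 => e0C e0A.
    by apply/subsetP => e eA; apply: cA e0C e0A eA.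
  have tab : touch (sum_label A g1 g2) (sum_label A k1 k2) a b.
    apply/touchP; exists x, y, x', y'.
    by rewrite /sum_label aA (disjointFl dAB bB) ga ka gb kb.
  have abC : (a \in C) = (b \in C).
    apply/idP/idP => cc; apply: cl cc _ _; rewrite ?inE ?bB ?aA ?orbT //.
    by rewrite touch_sym.
  have aC : a \in C.
    have := subsetP sC _ e0C; rewrite inE => /orP[e0A|e0B].
      exact: cA e0C e0A aA.
    by rewrite abC; apply: cB e0C e0B bB.
  apply/subsetP=> e; rewrite inE => /orP[]; first exact: (cA a).
  by apply: (cB b) => //; rewrite -abC.
- case: r1 => [A0|[a [x [y [aA ga ka]]]]].
    case: r2 => [B0|[b [x' [y' [bB gb kb]]]]]; first by left; rewrite A0 B0 setU0.
    right; exists b, x', y'; rewrite inE bB orbT /sum_label.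
    by rewrite (disjointFl dAB bB) gb kb.
  by right; exists a, x, y; rewrite inE aA /sum_label aA ga ka.
Qed.

(** * Planar pairs sharing a graph *)

Definition planar_step A (p p' : labeling X * labeling X) :=
  [/\ planar_pair A p.1 p.2, planar_pair A p'.1 p'.2
    & same_on A p.1 p'.1 \/ same_on A p.2 p'.2].

Definition reach A g k g' k' :=
  clos_refl_sym_trans _ (planar_step A) (g, k) (g', k').

Lemma reach_refl A g k : reach A g k g k. Proof. exact: rst_refl. Qed.

Lemma reach_sym A g k g' k' : reach A g k g' k' -> reach A g' k' g k.
Proof. exact: rst_sym. Qed.

Lemma reach_trans A g1 k1 g2 k2 g3 k3 :
  reach A g1 k1 g2 k2 -> reach A g2 k2 g3 k3 -> reach A g1 k1 g3 k3.
Proof. exact: rst_trans. Qed.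

Lemma reach_same A g k g' k' : planar_pair A g k ->
  same_on A g g' -> same_on A k k' -> reach A g k g' k'.
Proof.
move=> p s s'; apply: rst_step; split=> //=; last by left.
exact: same_on_planar s s' p.
Qed.

(** A shared second graph also fixes the cuts of the first one, by duality. *)
Lemma reach_cut A g k g' k' w : reach A g k g' k' -> cut A g w -> cut A g' w.
Proof.
rewrite /reach.
suff H (p p' : labeling X * labeling X) : clos_refl_sym_trans _ (planar_step A) p p' ->
    cut A p.1 w <-> cut A p'.1 w by move=> /H[].
elim=> {p p'} [p p' [] [dp _] [dp' _] []|||] //.
- by move=> s; split; apply: same_on_cut => //; apply: same_on_sym.
- move=> s; split => c.
    have [_ d _] := dp'; apply: d; apply: (same_on_orthogonal s).
    exact: cut_orthogonal dp c.
  have [_ d _] := dp; apply: d; apply: (same_on_orthogonal (same_on_sym s)).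
  exact: cut_orthogonal dp' c.
- by move=> p p' _ [].
- by move=> p1 p2 p3 _ [a b] _ [c d]; split; auto.
Qed.

(** Chooses the root to be the vertex at a given edge end. *)
Definition root_label g e0 x0 : labeling X :=
  fun e x => if g e x == g e0 x0 then 0 else (g e x).+1.

Lemma root_label_same A g e0 x0 : same_on A g (root_label g e0 x0).
Proof.
move=> e x e' x' _ _; rewrite /root_label.
case: ifP => [/eqP ->|h]; case: ifP => [/eqP ->|h']; rewrite ?eqxx ?eqSS ?h //.
by rewrite eq_sym h'.
Qed.

Lemma root_planar A g k e x y : e \in A -> planar_pair A g k ->
  planar_pair A (root_label g e x) (root_label k e y) /\
  rooted A (root_label g e x) (root_label k e y).
Proof.
move=> eA p; split; first exact: same_on_planar (root_label_same _ _ _) (root_label_same _ _ _) p.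
by right; exists e, x, y; rewrite /root_label !eqxx.
Qed.

Lemma sum_same A (D : {set X}) g1 g1' g2 g2' :
  (forall e x e' x', e \in A -> e' \in A -> (g1 e x == g1 e' x') = (g1' e x == g1' e' x')) ->
  (forall e x, e \in A -> (g1 e x == 0) = (g1' e x == 0)) ->
  (forall e x e' x', e \notin A -> e' \notin A -> e \in D -> e' \in D ->
      (g2 e x == g2 e' x') = (g2' e x == g2' e' x')) ->
  (forall e x, e \notin A -> e \in D -> (g2 e x == 0) = (g2' e x == 0)) ->
  same_on D (sum_label A g1 g2) (sum_label A g1' g2').
Proof.
move=> s1 z1 s2 z2 e x e' x' eD e'D; rewrite /sum_label.
case: ifP => eA; case: ifP => e'A.
- by have := s1 e x e' x' eA e'A; lia.
- have := z1 e x eA; have := z2 e' x' (negbT e'A) e'D; lia.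
- have := z1 e' x' e'A; have := z2 e x (negbT eA) eD; lia.
- have := s2 e x e' x' (negbT eA) (negbT e'A) eD e'D.
  have := z2 e x (negbT eA) eD; have := z2 e' x' (negbT e'A) e'D; lia.
Qed.

Section Attach.

Variables (A B : {set X}) (g2 k2 : labeling X).
Hypotheses (dAB : [disjoint A & B]) (p2 : planar_pair B g2 k2) (r2 : rooted B g2 k2).

(** The second summand is attached by its roots to the ends [x] and [y] of the edge [e] of the
   first one. *)
Let G g e x := sum_label A (root_label g e x) g2.
Let K k e y := sum_label A (root_label k e y) k2.

Lemma attach_planar g k e x y : planar_pair A g k -> e \in A ->
  planar_pair (A :|: B) (G g e x) (K k e y).
Proof.
move=> p eA; have [p' r'] := root_planar x y eA p.
by have [] := sum_planar dAB p' r' p2 r2.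
Qed.

(** Moving the point of attachment to another vertex on the same face changes the first graph
   only, moving it to another face at the same vertex changes the second graph only, and
   linkedness provides a route of such moves. *)
Lemma attach_walk g k e x y e' x' y' : planar_pair A g k -> e \in A -> e' \in A ->
  reach (A :|: B) (G g e x) (K k e y) (G g e' x') (K k e' y').
Proof.
move=> p eA e'A; have [_ lk] := p.
have turn a x1 y1 x2 y2 : a \in A -> reach (A :|: B) (G g a x1) (K k a y1) (G g a x2) (K k a y2).
  move=> aA; apply: (@reach_trans _ _ _ (G g a x1) (K k a y2));
    apply: rst_step; split; try exact: attach_planar.
    by left.
  by right.
suff H : forall x' y', reach (A :|: B) (G g e x) (K k e y) (G g e' x') (K k e' y') by [].
apply: (linked_ind (P := fun e' => forall x' y',
  reach (A :|: B) (G g e x) (K k e y) (G g e' x') (K k e' y')) lk _ eA e'A); last first.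
  by move=> x1 y1; apply: turn.
move=> a b aA bA /touchP[x1 [y1 [x2 [y2 [eg ek]]]]] IH x3 y3.
apply: reach_trans (IH x1 y1) _; apply: reach_trans (turn b x2 y2 x3 y3 bA).
apply: reach_same; first exact: attach_planar.
  by move=> c z c' z' _ _; rewrite /G /sum_label /root_label eg.
by move=> c z c' z' _ _; rewrite /K /sum_label /root_label ek.
Qed.

Lemma attach_step e x y p p' : e \in A -> planar_step A p p' ->
  reach (A :|: B) (G p.1 e x) (K p.2 e y) (G p'.1 e x) (K p'.2 e y).
Proof.
move=> eA [pp pp' s]; apply: rst_step; split; [exact: attach_planar..|].
have ss g g' x0 : same_on A g g' -> same_on (A :|: B) (sum_label A (root_label g e x0) g2)
   (sum_label A (root_label g' e x0) g2).
  move=> {}s; apply: sum_same => //.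
    by apply: same_on_trans (same_on_sym (root_label_same _ _ _)) (same_on_trans s (root_label_same _ _ _)).
  by move=> a z aA; rewrite /root_label (s a z e x0) //; case: ifP.
have ss' g g' x0 : same_on A g g' -> same_on (A :|: B) (sum_label A (root_label g e x0) k2)
   (sum_label A (root_label g' e x0) k2).
  move=> {}s; apply: sum_same => //.
    by apply: same_on_trans (same_on_sym (root_label_same _ _ _)) (same_on_trans s (root_label_same _ _ _)).
  by move=> a z aA; rewrite /root_label (s a z e x0) //; case: ifP.
by case: s => s; [left; apply: ss|right; apply: ss'].
Qed.

Lemma reach_planar g k g' k' : reach A g k g' k' -> planar_pair A g k -> planar_pair A g' k'.
Proof.
rewrite /reach.
suff H (p p' : labeling X * labeling X) : clos_refl_sym_trans _ (planar_step A) p p' ->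
    planar_pair A p.1 p.2 <-> planar_pair A p'.1 p'.2 by move=> /H[].
elim=> {p p'} [p p' []|||] //.
- by move=> p p' _ [].
- by move=> p1 p3 p4 _ [a b] _ [c d]; split; auto.
Qed.

Lemma attach_reach e x y g k g' k' : e \in A -> reach A g k g' k' ->
  reach (A :|: B) (G g e x) (K k e y) (G g' e x) (K k' e y).
Proof.
move=> eA; rewrite /reach.
suff H (p p' : labeling X * labeling X) : clos_refl_sym_trans _ (planar_step A) p p' ->
    reach (A :|: B) (G p.1 e x) (K p.2 e y) (G p'.1 e x) (K p'.2 e y) by move=> /H.
elim=> {p p'} [p p'|p|p p' _|p1 p3 p4 _ h1 _ h2].
- exact: attach_step.
- exact: reach_refl.
- exact: reach_sym.
- exact: reach_trans h1 h2.
Qed.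

Lemma sum_reachl g1 k1 g1' k1' : planar_pair A g1 k1 -> rooted A g1 k1 -> rooted A g1' k1' ->
  reach A g1 k1 g1' k1' ->
  reach (A :|: B) (sum_label A g1 g2) (sum_label A k1 k2)
                  (sum_label A g1' g2) (sum_label A k1' k2).
Proof.
move=> pA rA rA' re; have pA' := reach_planar re pA.
have aux g (l2 : labeling X) e x : e \in A -> g e x = 0 ->
    same_on (A :|: B) (sum_label A g l2) (sum_label A (root_label g e x) l2).
  move=> eA g0; apply: sum_same => // [|a z aA]; first exact: root_label_same.
  by rewrite /root_label g0; case: ifP.
have auxp g k : planar_pair A g k -> rooted A g k ->
    planar_pair (A :|: B) (sum_label A g g2) (sum_label A k k2).
  by move=> p r; have [] := sum_planar dAB p r p2 r2.
have [A0|[e [x [y [eA g0 k0]]]]] := rA.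
  apply: reach_same; first exact: auxp.
    by apply: sum_same => // e; rewrite A0 inE.
  by apply: sum_same => // e; rewrite A0 inE.
have [A0|[e' [x' [y' [e'A g0' k0']]]]] := rA'; first by rewrite A0 inE in eA.
apply: (@reach_trans _ _ _ (G g1 e x) (K k1 e y)).
  by apply: reach_same; [exact: auxp|exact: aux|exact: aux].
apply: reach_trans (attach_reach x y eA re) _.
apply: reach_trans (attach_walk x y x' y' pA' eA e'A) _.
apply: reach_sym.
by apply: reach_same; [exact: auxp|exact: aux|exact: aux].
Qed.

End Attach.

Lemma sum_swap A B g1 g2 : [disjoint A & B] ->
  same_on (A :|: B) (sum_label A g1 g2) (sum_label B g2 g1).
Proof.
move=> dAB e x e' x'; rewrite !inE /sum_label.
case: (boolP (e \in A)) => eA /=; rewrite ?(disjointFr dAB eA) //=;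
case: (boolP (e' \in A)) => e'A /=; rewrite ?(disjointFr dAB e'A) //= => eB e'B;
rewrite ?eB ?e'B; lia.
Qed.

Lemma sum_reach A B g1 k1 g2 k2 g1' k1' g2' k2' : [disjoint A & B] ->
  planar_pair A g1 k1 -> rooted A g1 k1 -> rooted A g1' k1' ->
  planar_pair B g2 k2 -> rooted B g2 k2 -> rooted B g2' k2' ->
  reach A g1 k1 g1' k1' -> reach B g2 k2 g2' k2' ->
  reach (A :|: B) (sum_label A g1 g2) (sum_label A k1 k2)
                  (sum_label A g1' g2') (sum_label A k1' k2').
Proof.
move=> dAB p1 r1 r1' p2 r2 r2' h1 h2.
apply: reach_trans (sum_reachl dAB p2 r2 p1 r1 r1' h1) _.
have p1' := reach_planar h1 p1; have p2' := reach_planar h2 p2.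
have dBA : [disjoint B & A] by rewrite disjoint_sym.
have := sum_reachl dBA p1' r1' p2 r2 r2' h2; rewrite setUC => h.
apply: (reach_trans (reach_trans _ h)).
  by apply: reach_same; [by have [] := sum_planar dAB p1' r1' p2 r2|exact: sum_swap..].
apply: reach_sym.
by apply: reach_same; [by have [] := sum_planar dAB p1' r1' p2' r2'|exact: sum_swap..].
Qed.

(** Used to regroup four summands, obtained by cutting [A] and its complement along [S], into
   a part in [S] and a part outside. *)
Lemma sum_interchange (D A S : {set X}) (a b c d : labeling X) :
  same_on D (sum_label A (sum_label S a b) (sum_label S c d))
            (sum_label S (sum_label A a c) (sum_label A b d)).
Proof.
move=> e x e' x' _ _; rewrite /sum_label.
by case: (e \in A); case: (e \in S); case: (e' \in A); case: (e' \in S); lia.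
Qed.

End Sums.

(** * Planar pairs with the same cuts *)

Section Reach.

Variable X : finType.

Implicit Types (g k : labeling X) (A B C S : {set X}) (u w : X -> bool) (q r : nat -> bool).

Lemma planar_vertex_connected A g k q : planar_pair A g k ->
  (forall e, e \in A -> coboundary g q e = false) ->
  forall e x e' x', e \in A -> e' \in A -> q (g e x) = q (g e' x').
Proof.
move=> [_ lk] q0 e x e' x' eA e'A.
have qe a z z' : a \in A -> q (g a z) = q (g a z').
  by move=> /q0; rewrite /coboundary; case: z; case: z' => //; case: (q _); case: (q _).
suff H : forall z, q (g e x) = q (g e' z) by [].
apply: (linked_ind (P := fun e' => forall z, q (g e x) = q (g e' z)) lk _ eA e'A) => [|z].
  move=> a b aA bA /touchP[x1 [y1 [x2 [y2 [eg _]]]]] IH z.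
  by rewrite (IH x1) eg; apply: qe.
exact: qe.
Qed.

(** Suppose that two vertices are shared. The part in [A1] of the star of the first one would
   be a cut; its function is constant on [A2], hence equal at both vertices, but on [A1] it
   differs by a constant from the indicator of the first vertex. *)
Lemma separation_vertex A1 A2 g k : [disjoint A1 & A2] ->
  planar_pair A1 g k -> planar_pair A2 g k -> separator (A1 :|: A2) g A1 ->
  forall e1 x1 e2 x2 e1' x1' e2' x2', e1 \in A1 -> e2 \in A2 -> e1' \in A1 -> e2' \in A2 ->
  g e1 x1 = g e2 x2 -> g e1' x1' = g e2' x2' -> g e1 x1 = g e1' x1'.
Proof.
move=> dA p1 p2 sp e1 x1 e2 x2 e1' x1' e2' x2' e1A e2A e1'A e2'A eq1 eq2.
have [q' qq'] := sp (pred1 (g e1 x1)).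
have z2 e : e \in A2 -> coboundary g q' e = false.
  by move=> eA2; rewrite -qq' ?inE ?eA2 ?orbT // (disjointFl dA eA2).
have z1 e : e \in A1 -> coboundary g (fun n => q' n (+) pred1 (g e1 x1) n) e = false.
  move=> eA1; have := qq' e; rewrite inE eA1 => /(_ isT); rewrite /coboundary.
  by rewrite addbACA => <-; rewrite addbb.
have h2 := planar_vertex_connected p2 z2 x2 x2' e2A e2'A.
have h1 := planar_vertex_connected p1 z1 x1 x1' e1A e1'A.
move: h1; rewrite /= eq1 h2 -eq2 -eq1 eqxx => /addbI/esym/eqP ->; by [].
Qed.

(** This is a decomposition of a diagram as a connected sum. The parts [A1] and [A2] are linked
   separators, so they are planar pairs by themselves; as they touch each other and share one
   vertex and one face, the whole pair is their sum. *)
Lemma planar_split A g k S : planar_pair A g k -> separator A g S ->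
  A :&: S != set0 -> A :\: S != set0 ->
  exists A1 A2, [/\ A = A1 :|: A2, [disjoint A1 & A2], A1 != set0, A2 != set0 &
    exists g1 k1 g2 k2,
     [/\ planar_pair A1 g1 k1 /\ rooted A1 g1 k1, planar_pair A2 g2 k2 /\ rooted A2 g2 k2,
         same_on A1 g g1, same_on A2 g g2 &
         same_on A g (sum_label A1 g1 g2) /\ same_on A k (sum_label A1 k1 k2)]].
Proof.
move=> pA spS nS nS'; have [dA lA] := pA.
have [A1 [A1A n1 n2 sp1 l1]] : exists A1, [/\ A1 \subset A, A1 != set0, A :\: A1 != set0,
    separator A g A1 & linked A1 g k].
  have [e] := set0Pn _ nS; rewrite inE => /andP[eA eS].
  have eAS : e \in A :&: S by rewrite inE eA.
  have [C [CS eC lC cC]] := linked_component g k eAS.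
  have sAS : A :&: S \subset A by apply: subsetIl.
  have spAS : separator A g (A :&: S).
    by move=> q; have [q' qq'] := spS q; exists q' => a aA; rewrite -qq' // inE aA.
  exists C; split => //.
  - exact: subset_trans CS sAS.
  - by apply/set0Pn; exists e.
  - have [a] := set0Pn _ nS'; rewrite inE => /andP[aS aA]; apply/set0Pn; exists a.
    rewrite inE aA andbT; apply: contra aS => /(subsetP CS); by rewrite inE => /andP[].
  - exact: touch_closed_separator dA sAS spAS CS cC.
(* A linked separator is enlarged by components of its complement until the complement is
   linked as well. *)
have [A1' [A1A' n1' n2' sp1' [l1' l2']]] : exists A1, [/\ A1 \subset A, A1 != set0, A :\: A1 != set0,
    separator A g A1 & linked A1 g k /\ linked (A :\: A1) g k].
  move: {2}#|A :\: A1| (leqnn #|A :\: A1|) => n.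
  elim: n A1 A1A n1 n2 sp1 l1 => [|n IHn] A1 A1A n1 n2 sp1 l1 cn.
    by move: n2; rewrite -card_gt0; lia.
  have [[e1 e2] /= [e1A1 e2A2 t12]] : exists p : X * X,
      [/\ p.1 \in A1, p.2 \in A :\: A1 & touch g k p.1 p.2].
    have [e1 e1A1] := set0Pn _ n1; have [e2] := set0Pn _ n2; rewrite inE => /andP[e2N e2A].
    case: (boolP [exists p : X * X, [&& p.1 \in A1, p.2 \in A :\: A1 & touch g k p.1 p.2]]).
      by case/existsP => p /and3P[]; exists p.
    move/existsPn => no; case/negP: e2N.
    apply: (linked_ind (P := fun e => e \in A1) lA _ (subsetP A1A _ e1A1) e2A e1A1).
    move=> a b aA bA t aA1; apply: contraT => bN; case/negP: (no (a, b)).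
    by rewrite /= aA1 inE bN bA t.
  have [C [CS eC lC cC]] := linked_component g k e2A2.
  have [CA|CA] := eqVneq C (A :\: A1); first by exists A1; rewrite -{2}CA.
  apply: (IHn (A1 :|: C)).
  - by rewrite subUset A1A (subset_trans CS) ?subsetDl.
  - by apply/set0Pn; exists e1; rewrite inE e1A1.
  - rewrite -setDDl setD_eq0; apply: contra CA => h.
    by rewrite eqEsubset CS.
  - apply: separatorU => //.
    by apply: touch_closed_separator dA (subsetDl _ _) (separatorD sp1) CS cC.
  - apply: linked_closed => D sD /set0Pn[d0 d0D] cl; apply/eqP; rewrite eqEsubset sD /=.
    have e1C : e1 \in A1 :|: C by rewrite inE e1A1.
    have e2C : e2 \in A1 :|: C by rewrite inE eC orbT.
    have to1 a b : a \in D -> a \in A1 -> b \in A1 -> b \in D.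
      move=> aD aA bA; apply: (linked_ind (P := fun e => e \in D) l1) aA bA aD.
      by move=> c d cA dA1 t cD; apply: cl cD _ t; rewrite inE dA1.
    have to2 a b : a \in D -> a \in C -> b \in C -> b \in D.
      move=> aD aA bA; apply: (linked_ind (P := fun e => e \in D) lC) aA bA aD.
      by move=> c d cA dA1 t cD; apply: cl cD _ t; rewrite inE dA1 orbT.
    have e12 : (e1 \in D) = (e2 \in D).
      apply/idP/idP => h; first exact: cl h e2C t12.
      by apply: cl h e1C _; rewrite touch_sym.
    have e1D : e1 \in D.
      have := subsetP sD _ d0D; rewrite inE => /orP[dA1|dC].
        exact: to1 d0D dA1 e1A1.
      by rewrite e12; apply: to2 d0D dC eC.
    apply/subsetP=> e; rewrite inE => /orP[]; first exact: (to1 e1).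
    by apply: (to2 e2) => //; rewrite -e12.
  - have c0 : 0 < #|C| by apply/card_gt0P; exists e2.
    have := cardsD (A :\: A1) C; rewrite (setIidPr CS) setDDl => ->.
    by rewrite leq_subLR; apply: leq_trans cn _; rewrite -add1n leq_add2r.
move: A1A' n1' n2' sp1' l1' l2' => {}A1A {}n1 {}n2 {}sp1 {}l1 l2 {A1}.
move: A1' A1A n1 n2 sp1 l1 l2 => A1 A1A n1 n2 sp1 l1 l2; set A2 := A :\: A1 in n2 l2.
have AE : A = A1 :|: A2 by rewrite /A2 setDE setUIr setUCr setIT (setUidPr A1A).
have dA12 : [disjoint A1 & A2] by rewrite -setI_eq0 /A2 setIDA setDIl setDv set0I.
have p1 : planar_pair A1 g k by split=> //; apply: dual_part sp1.
have p2 : planar_pair A2 g k.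
  by split=> //; apply: dual_part (separatorD sp1) => //; apply: subsetDl.
have spk : separator A k A1.
  move=> q; have [o _ d] := dA; apply: d => r.
  rewrite dot_restrict // dotC -(dot_restrict _ _ A1A).
  exact: (cut_orthogonal dA (sp1 r)).
(* The two parts touch at a vertex and a face, which become the roots. *)
have [e1 [e2 [e1A e2A /touchP[x1 [y1 [x2 [y2 [eg ek]]]]]]]] : exists e1 e2, [/\ e1 \in A1, e2 \in A2 & touch g k e1 e2].
  have [a aA1] := set0Pn _ n1; have [b] := set0Pn _ n2; rewrite inE => /andP[bN bA].
  case: (boolP [exists p : X * X, [&& p.1 \in A1, p.2 \in A2 & touch g k p.1 p.2]]).
    by case/existsP => p /and3P[]; exists p.1, p.2.
  move/existsPn => no; case/negP: bN.
  apply: (linked_ind (P := fun e => e \in A1) lA _ (subsetP A1A _ aA1) bA aA1).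
  move=> c d cA dAA t cA1; apply: contraT => dN; case/negP: (no (c, d)).
  by rewrite /= cA1 inE dN dAA t.
have gl (l : labeling X) (z1 z2 : bool) : l e1 z1 = l e2 z2 ->
    (forall e x e' x', e \in A1 -> e' \in A2 -> l e x = l e' x' -> l e x = l e1 z1) ->
    same_on A l (sum_label A1 (root_label l e1 z1) (root_label l e2 z2)).
  move=> el u e x e' x'; rewrite AE !inE /sum_label.
  have h1 a b : a \in A1 -> b \in A2 -> forall z z', (l a z == l b z') = (l a z == l e1 z1) && (l b z' == l e2 z2).
    move=> aA bA z z'; apply/eqP/andP => [eab|[/eqP -> /eqP ->]] //.
    by have := u _ _ _ _ aA bA eab; rewrite -eab -el => ->.
  case: (boolP (e \in A1)) => eA /=; rewrite ?(disjointFr dA12 eA) //= ?orbF;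
  case: (boolP (e' \in A1)) => e'A /=; rewrite ?(disjointFr dA12 e'A) //= ?orbF => eA2 e'A2.
  - by rewrite (root_label_same l e1 z1 x x' eA e'A) eq_double.
  - have e'2 : e' \in A2 by rewrite inE e'A.
    by rewrite (h1 e e') // eq_double_double_pred /root_label; case: (_ == l e1 z1); case: (_ == l e2 z2).
  - have e2' : e \in A2 by rewrite inE eA.
    rewrite eq_sym (h1 e' e) // [RHS]eq_sym eq_double_double_pred /root_label.
    by case: (_ == l e1 z1); case: (_ == l e2 z2).
  - by rewrite (root_label_same (A := A) l e2 z2 x x' eA2 e'A2) eq_double_pred.
exists A1, A2; split=> //.
exists (root_label g e1 x1), (root_label k e1 y1), (root_label g e2 x2), (root_label k e2 y2).
split; [exact: root_planar|exact: root_planar|exact: root_label_same|exact: root_label_same|].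
rewrite AE in sp1 spk; split; apply: gl => // e x e' x' eA e'A eq.
  exact: (separation_vertex dA12 p1 p2 sp1 eA e'A e1A e2A eq eg).
exact: (separation_vertex dA12 (planar_pairC p1) (planar_pairC p2) spk eA e'A e1A e2A eq ek).
Qed.

Lemma sum_labelE S A B (g1 g2 : labeling X) e x : A \subset S -> [disjoint B & S] ->
  e \in A :|: B -> sum_label S g1 g2 e x = sum_label A g1 g2 e x.
Proof.
move=> /subsetP sAS dBS; rewrite inE /sum_label; case: (boolP (e \in A)) => eA /=.
  by rewrite sAS.
by move=> eB; rewrite (disjointFr dBS eB).
Qed.

Lemma sum_planar_in S A B g1 k1 g2 k2 : A \subset S -> [disjoint B & S] ->
  planar_pair A g1 k1 /\ rooted A g1 k1 -> planar_pair B g2 k2 /\ rooted B g2 k2 ->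
  planar_pair (A :|: B) (sum_label S g1 g2) (sum_label S k1 k2) /\
  rooted (A :|: B) (sum_label S g1 g2) (sum_label S k1 k2).
Proof.
move=> sAS dBS [p1 r1] [p2 r2].
have dAB : [disjoint A & B] by rewrite disjoint_sym; apply: disjointWr sAS dBS.
have [p r] := sum_planar dAB p1 r1 p2 r2; split.
  by apply: same_on_planar p => e x e' x' eD e'D; rewrite !(sum_labelE _ _ _ sAS dBS).
case: r => [->|[e [x [y [eD g0 k0]]]]]; [by left|right].
by exists e, x, y; rewrite !(sum_labelE _ _ _ sAS dBS).
Qed.

Lemma separator_same A g g' S : same_on A g g' -> separator A g S -> separator A g' S.
Proof.
move=> s sp q; have [q0 qq0] := same_on_coboundary q (same_on_sym s).
apply: (same_on_cut s); have [q1 qq1] := sp q0.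
by exists q1 => e eA; rewrite -qq1 // qq0.
Qed.

Lemma planar_pair0 g k : planar_pair set0 g k.
Proof.
split; first by split=> [q r|w _|w _]; [rewrite /dot big_set0|exists xpredT => e|exists xpredT => e];
  rewrite // inE.
by apply/forall_inP=> e; rewrite inE.
Qed.

Lemma planar_root A g k : planar_pair A g k -> exists g' k',
  [/\ planar_pair A g' k' /\ rooted A g' k', same_on A g g' & same_on A k k'].
Proof.
move=> p; have [->|/set0Pn[e eA]] := eqVneq A set0.
  by exists g, k; split=> //; split; [exact: planar_pair0|left].
exists (root_label g e false), (root_label k e false).
by split; [exact: root_planar|exact: root_label_same|exact: root_label_same].
Qed.

(** Any separator can be made the first summand of a sum: split somewhere,
   decompose the two smaller pairs and regroup the four summands. *)
Lemma planar_decompose A g k S : planar_pair A g k -> separator A g S ->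
  exists g1 k1 g2 k2,
    [/\ planar_pair (A :&: S) g1 k1 /\ rooted (A :&: S) g1 k1,
        planar_pair (A :\: S) g2 k2 /\ rooted (A :\: S) g2 k2
      & reach A g k (sum_label S g1 g2) (sum_label S k1 k2)].
Proof.
move: {2}#|A| (leqnn #|A|) => n; elim: n A g k => [|n IHn] A g k cA p sp.
  have A0 : A = set0 by apply/eqP; rewrite -cards_eq0 -leqn0.
  exists g, k, g, k; rewrite A0 set0I set0D; split; try by split; [exact: planar_pair0|left].
  by apply: reach_same; [exact: planar_pair0|move=> e x e' x'; rewrite inE..].
have [g0 [k0 [p0 sg sk]]] := planar_root p.
have [AS0|nS] := eqVneq (A :&: S) set0.
  exists g, k, g0, k0; have nS e : e \in A -> e \in S = false.
    by move=> eA; apply/negP => eS; have := in_set0 e; rewrite -AS0 inE eA eS.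
  have -> : A :\: S = A by apply/setP=> e; rewrite inE; case eA: (e \in A); rewrite ?andbF // nS.
  rewrite AS0; split=> //; first by split; [exact: planar_pair0|left].
  apply: reach_same p _ _ => e x e' x' eA e'A; rewrite /sum_label !nS //.
    by rewrite (sg e x e' x' eA e'A) eq_double_pred.
  by rewrite (sk e x e' x' eA e'A) eq_double_pred.
have [AS0|nS'] := eqVneq (A :\: S) set0.
  exists g0, k0, g, k; have iS e : e \in A -> e \in S.
    by move=> eA; apply: contraT => eS; have := in_set0 e; rewrite -AS0 inE eA eS.
  have -> : A :&: S = A by apply/setIidPl/subsetP.
  rewrite AS0; split=> //; first by split; [exact: planar_pair0|left].
  apply: reach_same p _ _ => e x e' x' eA e'A; rewrite /sum_label !iS //.
    by rewrite (sg e x e' x' eA e'A) eq_double.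
  by rewrite (sk e x e' x' eA e'A) eq_double.
have [A1 [A2 [AE dA n1 n2 [g1 [k1 [g2 [k2 [[p1 r1] [p2 r2] s1 s2 [ss ssk]]]]]]]]] :=
  planar_split p sp nS nS'.
have cA12 : #|A| = #|A1| + #|A2| by rewrite AE cardsU (disjoint_setI0 dA) cards0 subn0.
have sA1 : A1 \subset A by rewrite AE subsetUl.
have sA2 : A2 \subset A by rewrite AE subsetUr.
rewrite -card_gt0 in n1; rewrite -card_gt0 in n2.
have [||a [ka [b [kb [pa pb rab]]]]] := IHn A1 g1 k1 _ p1.
- by clear -cA cA12 n2; lia.
- by apply: (separator_same s1); apply: separatorS sp.
have [||c [kc [d [kd [pc pd rcd]]]]] := IHn A2 g2 k2 _ p2.
- by clear -cA cA12 n1; lia.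
- by apply: (separator_same s2); apply: separatorS sp.
exists (sum_label A1 a c), (sum_label A1 ka kc), (sum_label A1 b d), (sum_label A1 kb kd).
have d21 : [disjoint A2 & A1] by rewrite disjoint_sym.
split.
- rewrite [in A :&: S]AE setIUl; apply: sum_planar_in => //; first exact: subsetIl.
  exact: disjointWl (subsetIl _ _) d21.
- rewrite [in A :\: S]AE setDUl; apply: sum_planar_in => //; first exact: subsetDl.
  exact: disjointWl (subsetDl _ _) d21.
apply: (@reach_trans _ _ _ _ (sum_label A1 g1 g2) (sum_label A1 k1 k2)).
  exact: reach_same.
have r4 : reach A (sum_label A1 g1 g2) (sum_label A1 k1 k2)
  (sum_label A1 (sum_label S a b) (sum_label S c d))
  (sum_label A1 (sum_label S ka kb) (sum_label S kc kd)).
  have rr B l kl m km : planar_pair (B :&: S) l kl /\ rooted (B :&: S) l kl ->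
      planar_pair (B :\: S) m km /\ rooted (B :\: S) m km ->
      rooted B (sum_label S l m) (sum_label S kl km).
    move=> pl pm; rewrite -{1}(setID B S); apply: proj2.
    by apply: sum_planar_in => //; [exact: subsetIr|rewrite -setI_eq0 setIDAC setDIl setDv setI0].
  by rewrite AE; apply: sum_reach => //; apply: rr.
apply: (reach_trans r4); apply: reach_same; [|exact: sum_interchange..].
by apply: (reach_planar r4); apply: same_on_planar ss ssk p.
Qed.

(** Duality depends only on the cut spaces, and the first graphs have the same one. *)
Lemma same_cuts_planar A g k g' k' : planar_pair A g k -> planar_pair A g' k' ->
  (forall w, cut A g w <-> cut A g' w) -> abstract_dual A g k'.
Proof.
move=> [d _] [d' _] cc; have [_ d1 d2] := d; have [_ d1' d2'] := d'.
split=> [q|w ow|w ow].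
- by apply: (cut_orthogonal d'); apply/cc; exists q.
- by apply/cc; apply: d1'.
- apply: d2' => q; apply: (orthogonal_cut ow); apply/cc; by exists q.
Qed.

Lemma part_cut A C (g1 g1' G G' : labeling X) w : C \subset A ->
  same_on C g1 G -> same_on C g1' G' -> (forall w, cut A G w -> cut A G' w) ->
  cut C g1 w -> cut C g1' w.
Proof.
move=> sCA s s' cc /(same_on_cut s)[q wq].
have /(cut_restrict sCA)/(same_on_cut (same_on_sym s'))[q' qq'] : cut A G' (coboundary G q).
  by apply: cc; exists q.
by exists q' => e eC; rewrite -qq' // wq.
Qed.

(** If the mixed pair [g], [k'] is linked, then it is planar and shares a graph with both pairs.
   Otherwise its linked parts are separators, along which both pairs are decomposed. *)
Theorem same_cuts_reach A g k g' k' : planar_pair A g k -> planar_pair A g' k' ->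
  (forall w, cut A g w <-> cut A g' w) -> reach A g k g' k'.
Proof.
move: {2}#|A| (leqnn #|A|) => n; elim: n A g k g' k' => [|n IHn] A g k g' k' cA p p' cc.
  have A0 : A = set0 by apply/eqP; rewrite -cards_eq0 -leqn0.
  by rewrite A0; apply: reach_same; [exact: planar_pair0|move=> e x e' x'; rewrite inE..].
have dgk' := same_cuts_planar p p' cc.
case: (boolP (linked A g k')) => [lk|/unlinked_part[C [CA nC CnA cl]]].
  apply: (@reach_trans _ _ _ _ g k'); apply: rst_step; split=> //; by [left|right].
have spC : separator A g C by apply: touch_closed_separator dgk' _ (separatorT _ _) CA cl.
have spC' : separator A g' C.
  move=> q; have [q0 qq0] : cut A g (coboundary g' q) by apply/cc; exists q.
  apply/cc; have [q1 qq1] := spC q0; exists q1 => e eA; by rewrite -qq1 // qq0.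
have [g1 [k1 [g2 [k2 [[p1 r1] [p2 r2] re]]]]] := planar_decompose p spC.
have [g1' [k1' [g2' [k2' [[p1' r1'] [p2' r2'] re']]]]] := planar_decompose p' spC'.
apply: (reach_trans re (reach_trans _ (reach_sym re'))).
have cs w : cut A (sum_label C g1 g2) w <-> cut A (sum_label C g1' g2') w.
  split=> h; [apply: (reach_cut re'); apply/cc; apply: (reach_cut (reach_sym re))|
              apply: (reach_cut re); apply/cc; apply: (reach_cut (reach_sym re'))]; exact: h.
have AC : A :&: C = C by apply/setIidPr.
have AE : A = C :|: (A :\: C) by rewrite -{1}(setID A C) AC.
have dC : [disjoint C & A :\: C] by rewrite -setI_eq0 setIDA setDIl setDv set0I.
have cAC : #|A| = #|C| + #|A :\: C| by rewrite -{1}AC cardsID.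
have nC' : 0 < #|A :\: C| by rewrite card_gt0 setD_eq0; apply: contra CnA => h; rewrite eqEsubset CA.
rewrite -card_gt0 in nC.
rewrite AC in p1 r1 p1' r1'; rewrite [in reach A]AE; apply: sum_reach => //.
  apply: IHn => //; first by clear -cA cAC nC'; lia.
  move=> w; have [l l'] := (@sum_same_onl X C g1 g2, @sum_same_onl X C g1' g2').
  by split; [exact: (part_cut CA l l' (fun w' => (cs w').1))|exact: (part_cut CA l' l (fun w' => (cs w').2))].
apply: IHn => //; first by clear -cA cAC nC; lia.
move=> w; have [l l'] := (sum_same_onr g1 g2 dC, sum_same_onr g1' g2' dC).
have sD := subsetDl A C.
by split; [exact: (part_cut sD l l' (fun w' => (cs w').1))|exact: (part_cut sD l' l (fun w' => (cs w').2))].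
Qed.

End Reach.

(** * Ranks over the field with two elements *)

Section Rank.

Import GRing.Theory.

Variable X : finType.

Definition vertex_coboundary (V : Type) (g : X -> bool -> V) (q : V -> bool) (e : X) : bool :=
  q (g e false) (+) q (g e true).

Definition vertex_connected (V : finType) (g : X -> bool -> V) :=
  0 < #|V| /\ forall q : V -> bool,
    (forall e, vertex_coboundary g q e = false) -> forall v v', q v = q v'.

Local Open Scope ring_scope.

Definition bit (b : bool) : 'F_2 := b%:R.

Lemma bit_add a b : bit (a (+) b) = bit a + bit b.
Proof. by case: a; case: b; rewrite /bit ?addr0 ?add0r //; apply/val_inj. Qed.

Lemma bit_and a b : bit (a && b) = bit a * bit b.
Proof. by case: a; case: b; rewrite /bit ?mulr1 ?mulr0 ?mul0r. Qed.

Lemma bitK (x : 'F_2) : bit (x != 0) = x.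
Proof. by case: x => [[|[|n]] //= lt]; apply/val_inj. Qed.

Lemma bit_inj : injective bit.
Proof. by move=> [] [] // /(congr1 val). Qed.

Definition bit_row (T : finType) (w : T -> bool) : 'rV['F_2]_#|T| :=
  \row_i bit (w (enum_val i)).

Lemma bit_rowK (T : finType) (r : 'rV['F_2]_#|T|) :
  r = bit_row (fun v => r 0 (enum_rank v) != 0).
Proof. by apply/rowP => i; rewrite mxE bitK enum_valK. Qed.

Lemma bit_dot u w : bit_row u *m (bit_row w)^T = (bit (@dot X setT u w))%:M.
Proof.
apply/rowP => i; rewrite !ord1 !mxE eqxx mulr1n /dot.
rewrite (big_morph bit bit_add (erefl _ : bit false = 0)).
rewrite [RHS](eq_bigl xpredT) => [|j]; last by rewrite inE.
rewrite (reindex _ (onW_bij _ (enum_val_bij X))) /=.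
by apply: eq_bigr => j _; rewrite !mxE bit_and.
Qed.

Definition incidence (V : finType) (g : X -> bool -> V) : 'M['F_2]_(#|V|, #|X|) :=
  \matrix_(i, j) bit (vertex_coboundary g (pred1 (enum_val i)) (enum_val j)).

Lemma bit_row_incidence (V : finType) (g : X -> bool -> V) q :
  bit_row q *m incidence g = bit_row (vertex_coboundary g q).
Proof.
apply/rowP => j; rewrite !mxE.
have pick v : \sum_(i < #|V|) bit (q (enum_val i)) * bit (v == enum_val i) = bit (q v).
  rewrite (bigD1 (enum_rank v)) //= enum_rankK eqxx mulr1 big1 ?addr0 // => i ni.
  case: eqP => [vi|_]; last by rewrite mulr0.
  by rewrite vi enum_valK eqxx in ni.
rewrite /vertex_coboundary bit_add -!pick -big_split; apply: eq_bigr => i _ /=.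
by rewrite !mxE bit_add mulrDr.
Qed.

(** The constant functions are the only ones without a cut, so the left kernel is a line. *)
Lemma rank_incidence (V : finType) (g : X -> bool -> V) :
  vertex_connected g -> (\rank (incidence g)).+1 = #|V|.
Proof.
move=> [V0 cg].
have kerE : (kermx (incidence g) :=: (const_mx 1 : 'rV_#|V|))%MS.
  apply/eqmxP/andP; split.
    apply/rV_subP => r /sub_kermxP; rewrite (bit_rowK r) bit_row_incidence => r0.
    have c e : vertex_coboundary g (fun v => r 0 (enum_rank v) != 0) e = false.
      by apply: bit_inj; have /rowP/(_ (enum_rank e)) := r0; rewrite !mxE enum_rankK.
    have [v0 _] := card_gt0P V0.
    suff -> : bit_row (fun v : V => r 0 (enum_rank v) != 0) =
       bit (r 0 (enum_rank v0) != 0) *: const_mx 1 by apply: scalemx_sub.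
    by apply/rowP=> i; rewrite !mxE mulr1 (cg _ c (enum_val i) v0).
  apply/sub_kermxP; have -> : const_mx 1 = bit_row (fun _ : V => true).
    by apply/rowP=> i; rewrite !mxE.
  by rewrite bit_row_incidence; apply/rowP=> i; rewrite !mxE.
have r1 : \rank (kermx (incidence g)) = 1%N.
  rewrite kerE rank_rV; case: eqP => // /rowP.
  by have [v0 _] := card_gt0P V0 => /(_ (enum_rank v0)); rewrite !mxE => /eqP; rewrite oner_eq0.
have := mxrank_ker (incidence g); rewrite r1.
have := rank_leq_row (incidence g); lia.
Qed.

Variables (V F : finType) (g : X -> bool -> V) (k : X -> bool -> F).
Hypotheses (cg : vertex_connected g) (ck : vertex_connected k).
Hypothesis orth : forall q r,
  dot setT (vertex_coboundary g q) (vertex_coboundary k r) = false.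

Lemma incidence_orthogonal : incidence g *m (incidence k)^T = 0.
Proof.
apply/matrixP=> i j; rewrite !mxE.
transitivity (bit (dot setT (vertex_coboundary g (pred1 (enum_val i)))
                            (vertex_coboundary k (pred1 (enum_val j))))); last by rewrite orth.
rewrite /dot (big_morph bit bit_add (erefl _ : bit false = 0)).
rewrite [RHS](eq_bigl xpredT) => [|e]; last by rewrite inE.
rewrite (reindex _ (onW_bij _ (enum_val_bij X))) /=.
by apply: eq_bigr => e _; rewrite !mxE bit_and.
Qed.

Lemma rank_orthogonal :
  ((\rank (kermx (incidence k)^T)).+1 + #|F| = #|X| + 2)%N.
Proof.
rewrite mxrank_ker mxrank_tr.
have := rank_incidence ck; have := rank_leq_col (incidence k).
by move: (\rank _) => n; lia.
Qed.

Lemma orthogonal_card : (#|V| + #|F| <= #|X| + 2)%N.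
Proof.
rewrite -rank_orthogonal leq_add2r -(rank_incidence cg) ltnS.
by apply: mxrankS; apply/sub_kermxP/incidence_orthogonal.
Qed.

Lemma orthogonal_bit_row w :
  (forall r, dot setT w (vertex_coboundary k r) = false) <->
  (bit_row w <= kermx (incidence k)^T)%MS.
Proof.
split=> [ow|/sub_kermxP ow r].
  apply/sub_kermxP/rowP=> j; rewrite !mxE.
  transitivity (bit (dot setT w (vertex_coboundary k (pred1 (enum_val j))))); last by rewrite ow.
  rewrite /dot (big_morph bit bit_add (erefl _ : bit false = 0)).
  rewrite [RHS](eq_bigl xpredT) => [|e]; last by rewrite inE.
  rewrite (reindex _ (onW_bij _ (enum_val_bij X))) /=.
  by apply: eq_bigr => e _; rewrite !mxE bit_and.
apply: bit_inj; have /matrixP/(_ 0 0) := bit_dot w (vertex_coboundary k r).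
by rewrite -bit_row_incidence trmx_mul mulmxA ow mul0mx !mxE eqxx mulr1n => <-.
Qed.

(** The cuts of [g] form a subspace of the orthogonal complement of the cuts of [k]; by the
   ranks both have the same dimension exactly when the Euler formula holds. *)
Lemma euler_cut w : (#|V| + #|F| = #|X| + 2)%N ->
  (forall r, dot setT w (vertex_coboundary k r) = false) ->
  exists q, forall e, w e = vertex_coboundary g q e.
Proof.
move=> eul /orthogonal_bit_row sw.
have s : (incidence g <= kermx (incidence k)^T)%MS by apply/sub_kermxP/incidence_orthogonal.
have /eqmxP/eqmx_sym eqm : (incidence g == kermx (incidence k)^T)%MS.
  rewrite -(mxrank_leqif_eq s); apply/eqP.
  by have := rank_orthogonal; have := rank_incidence cg; lia.
move: sw; rewrite eqm => /submxP[p]; rewrite {1}(bit_rowK p) bit_row_incidence => /rowP wp.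
exists (fun v => p 0 (enum_rank v) != 0) => e.
by apply: bit_inj; have := wp (enum_rank e); rewrite !mxE enum_rankK.
Qed.

Lemma cut_euler :
  (forall w, (forall r, dot setT w (vertex_coboundary k r) = false) ->
     exists q, forall e, w e = vertex_coboundary g q e) ->
  (#|V| + #|F| = #|X| + 2)%N.
Proof.
move=> d; apply/eqP; rewrite eqn_leq orthogonal_card /=.
rewrite -rank_orthogonal leq_add2r -(rank_incidence cg) ltnS; apply: mxrankS.
apply/rV_subP=> r; rewrite (bit_rowK r) => /orthogonal_bit_row/d[q wq].
apply/submxP; exists (bit_row q); rewrite bit_row_incidence.
by apply/rowP=> j; rewrite !mxE wq.
Qed.

End Rank.

(** * Graphs given by labelings *)

Section Depict.

Variable X : finType.

(** The bijection [th] names the edges of [G], and the vertices of [G] correspond to the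
   labels in use; in particular each vertex is the end of an edge. *)
Definition depicts (G : sgraph) (th : X -> edge G) (g : labeling X) (sg : X -> bool) :=
  bijective th /\ exists rg : X -> bool -> vertex G,
    [/\ forall e, ends (th e) = [set rg e false; rg e true],
        forall e x e' x', (rg e x == rg e' x') = (g e x == g e' x'),
        forall v, exists e x, v = rg e x
      & forall e, sign (th e) = sg e].

Lemma depicts_isomorphic (G H : sgraph) (th : X -> edge G) (th' : X -> edge H) g g' sg :
  depicts th g sg -> depicts th' g' sg -> same_on setT g g' -> signed_isomorphic G H.
Proof.
move=> [[thV thK thVK] [rg [eg pg sug sgn]]] [[thV' thK' thVK'] [rg' [eg' pg' sug' sgn']]] sg0.
have tr e x e' x' : (rg e x == rg e' x') = (rg' e x == rg' e' x').
  by rewrite pg pg' sg0 ?inE.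
have ex v : exists p : X * bool, v == rg p.1 p.2.
  by have [e [x ->]] := sug v; exists (e, x).
have ex' v : exists p : X * bool, v == rg' p.1 p.2.
  by have [e [x ->]] := sug' v; exists (e, x).
pose fV v := let p := xchoose (ex v) in rg' p.1 p.2.
pose fV' v := let p := xchoose (ex' v) in rg p.1 p.2.
have fE e x : fV (rg e x) = rg' e x.
  by apply/eqP; rewrite /fV -tr eq_sym; apply: (xchooseP (ex (rg e x))).
have fE' e x : fV' (rg' e x) = rg e x.
  by apply/eqP; rewrite /fV' tr eq_sym; apply: (xchooseP (ex' (rg' e x))).
exists fV, (fun e => th' (thV e)); split; last by move=> e; rewrite sgn' -sgn thVK.
split.
- exists fV' => v; first by have [e [x ->]] := sug v; rewrite fE fE'.
  by have [e [x ->]] := sug' v; rewrite fE' fE.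
- by exists (fun e => th (thV' e)) => e; rewrite ?thK' ?thVK ?thK ?thVK'.
- by move=> e; have := eg (thV e); rewrite thVK eg' => ->; rewrite imsetU1 imset_set1 !fE.
Qed.

End Depict.

(** Duality from the Euler formula, for graphs without isolated vertices whose vertices are
   encoded by numbers. *)
Lemma label_planar (X V F : finType) (gV : X -> bool -> V) (kF : X -> bool -> F)
    (iV : V -> nat) (iF : F -> nat) : injective iV -> injective iF ->
  vertex_connected gV -> vertex_connected kF ->
  (forall q r, dot setT (vertex_coboundary gV q) (vertex_coboundary kF r) = false) ->
  #|V| + #|F| = #|X| + 2 ->
  abstract_dual setT (fun e x => iV (gV e x)) (fun e x => iF (kF e x)).
Proof.
move=> injV injF cV cF o eul.
have pull (T : finType) (i : T -> nat) (l : X -> bool -> T) q : injective i -> exists q',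
    forall e, coboundary (fun e x => i (l e x)) q' e = vertex_coboundary l q e.
  move=> injT; exists (fun n => [exists v, (i v == n) && q v]) => e.
  suff H v : [exists u, (i u == i v) && q u] = q v by rewrite /coboundary !H.
  apply/existsP/idP => [[u /andP[/eqP/injT ->]]//|qv]; by exists v; rewrite eqxx.
split=> [q r|w ow|w ow].
- exact: o (fun v => q (iV v)) (fun v => r (iF v)).
- have [r|q wq] := euler_cut cV cF o eul (w := w).
    by have [r' rr'] := pull _ iF kF r injF; rewrite -(ow r'); apply: eq_dot.
  by have [q' qq'] := pull _ iV gV q injV; exists q' => e _; rewrite wq qq'.
- have o' q r : dot setT (vertex_coboundary kF q) (vertex_coboundary gV r) = false.
    by rewrite dotC o.
  have [|r|q wq] := euler_cut cF cV o' _ (w := w); first by rewrite addnC.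
    by have [r' rr'] := pull _ iV gV r injV; rewrite -(ow r'); apply: eq_dot.
  by have [q' qq'] := pull _ iF kF q injF; exists q' => e _; rewrite wq qq'.
Qed.

(** * The planar pair of a diagram *)

Lemma next_cwK (Y : finType) : cancel (@next_cw Y) (@next_ccw Y).
Proof. by case=> c i; rewrite /next_ccw /next_cw /= ord_predK. Qed.

(** An invariant of a permutation that takes all values separates the orbits exactly when
   there are as many orbits as values. *)
Lemma fcard_labels (T R : finType) (f : T -> T) (l : T -> R) : injective f ->
  (forall x, l (f x) = l x) -> (forall r, exists x, l x = r) ->
  #|R| <= fcard f predT /\
  (fcard f predT = #|R| <-> forall x y, l x = l y -> fconnect f x y).
Proof.
move=> fI lf ls; have fs := fconnect_sym fI.
have lroot x : l (froot f x) = l x.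
  have : fconnect f x (froot f x) by apply: connect_root.
  by case/connectP=> p pp ->; elim: p x pp => //= z p IHp x /andP[/eqP <-] /IHp ->.
pose rts := [set x | froots f x].
have rtsP x : froot f x \in rts by rewrite inE; apply: roots_root fs _.
have im : l @: rts = setT.
  apply/setP=> r; rewrite inE; have [x <-] := ls r.
  by apply/imsetP; exists (froot f x); rewrite ?lroot.
have -> : fcard f predT = #|rts| by apply: eq_card => h; rewrite !inE andbT.
split; first by rewrite -cardsT -im leq_imset_card.
split=> [eqc x y xy|con].
  have inj : {in rts &, injective l} by apply/imset_injP; rewrite im cardsT eqc.
  by rewrite -(root_connect fs); apply/eqP; apply: inj; rewrite ?rtsP // !lroot.
rewrite -[RHS]cardsT -im card_in_imset // => x y; rewrite !inE => /eqP rx /eqP ry /con.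
by rewrite -(root_connect fs) rx ry => /eqP.
Qed.

Section Corners.

Variables (D : link_diagram) (s : coloring D).

Lemma shade_cornerE c (i : 'I_4) : s (corner (c, i)) = s (corner (c, ord0)) (+) odd i.
Proof.
have st (j : 'I_4) : s (corner (c, ordS j)) = ~~ s (corner (c, j)).
  by have := shade_corner s (c, j); rewrite /next_ccw /=; do 2!case: (s _).
suff H n : n < 4 -> s (corner (c, inord n)) = s (corner (c, ord0)) (+) odd n.
  by rewrite -[in LHS](inord_val i) H.
elim: n => [_|n IHn ltn].
  by rewrite addbF; congr (s (corner (c, _))); apply/val_inj; rewrite /= inordK.
have -> : inord n.+1 = ordS (inord n : 'I_4).
  by apply/val_inj; rewrite /= !inordK ?modn_small // ltnW.
by rewrite st IHn ?(ltnW ltn) //= addbN.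
Qed.

(** Around a crossing the colors alternate, so the regions of color [b] are at the corners
   0 and 2 or at the corners 1 and 3. *)
Definition region_at b (c : crossing D) (x : bool) : region D :=
  corner (c, inord ((s (corner (c, ord0)) != b) + 2 * x)).

Lemma shade_region_at b c x : s (region_at b c x) = b.
Proof.
rewrite /region_at shade_cornerE inordK; last by case: (_ != b); case: x.
by case: (s _); case: b; case: x.
Qed.

Lemma corner_region_at c (i : 'I_4) : corner (c, i) = region_at (s (corner (c, i))) c (1 < i).
Proof.
rewrite /region_at (shade_cornerE c i); congr (corner (c, _)); apply/val_inj.
by case: i => [[|[|[|[|i]]]]] //= lt; rewrite inordK; case: (s _).
Qed.

Lemma mem_crossing_ends b c x : s (region_at b c x) == b.
Proof. by rewrite shade_region_at. Qed.

Definition colored_region_at b c x : colored_region s b :=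
  exist _ (region_at b c x) (mem_crossing_ends b c x).

Lemma crossing_endsE b (c : crossing D) :
  crossing_ends s b c = [set colored_region_at b c false; colored_region_at b c true].
Proof.
apply/setP=> r; rewrite !inE -!val_eqE /=.
apply/existsP/orP => [[i /eqP ci]|[] /eqP ->]; last 2 first.
- by eexists; apply: eqxx.
- by eexists; apply: eqxx.
have := corner_region_at c i; rewrite ci (eqP (valP r)) => ->.
by case: (1 < i); [right|left].
Qed.

(** The summand of a crossing is a sum over its four half-edges, each of which separates a
   region of color [b] from one of the other color. Both halves of an arc separate the same
   regions, so their terms cancel. *)
Lemma region_orthogonal b (q r : region D -> bool) :
  \big[addb/false]_c ((q (region_at b c false) (+) q (region_at b c true)) &&
    (r (region_at (~~ b) c false) (+) r (region_at (~~ b) c true))) = false.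
Proof.
pose a (h : half_edge (crossing D)) := corner h.
pose a' (h : half_edge (crossing D)) := corner (next_cw h).
pose Phi h := if s (a h) == b then q (a h) && r (a' h) else q (a' h) && r (a h).
have aa' h : s (a h) = ~~ s (a' h).
  by have := shade_corner s (next_cw h); rewrite next_cwK -/(a' h) -/(a h); do 2!case: (s _).
have ao h : a' (opp h) = a h by apply: corner_next.
have ao' h : a (opp h) = a' h by rewrite -{2}(opp_involutive h) ao.
have tot : \big[addb/false]_h Phi h = false.
  apply: (xor_invariant (@opp_involutive D)) => // h _; first exact: opp_neq.
  rewrite /Phi ao ao' aa' {Phi}.
  by case: (s (a' h)); case: b.
rewrite -[RHS]tot.
transitivity (\big[addb/false]_c \big[addb/false]_(i : 'I_4) Phi (c, i)); last first.
  by rewrite pair_big /=; apply: eq_bigr => -[].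
apply: eq_bigr => c _; rewrite {tot}/Phi /a' /a {Phi a a' aa' ao ao'} /next_cw /=.
have [k [kE kI]] : exists k : nat -> region D, (forall i : 'I_4, corner (c, i) = k i) /\
    (forall n, corner (c, inord n) = k n).
  by exists (fun n => corner (c, inord n)); split=> [i|//]; rewrite inord_val.
have sk (i : 'I_4) : s (k i) = s (k 0) (+) odd i by rewrite -kE shade_cornerE kE.
rewrite /region_at !kI !big_ord_recl big_ord0 !kE !sk /= /bump /=.
rewrite ?(addn0, add0n, addn1, add1n) /=.
have [-> -> -> ->] : [/\ 3 %% 4 = 3, 4 %% 4 = 0, 5 %% 4 = 1 & 6 %% 4 = 2] by [].
case: (s (k 0)); case: b => /=; rewrite ?(add0n, add1n, muln1, muln0);
  by case: (q _); case: (q _); case: (r _); case: (r _).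
Qed.

(** Speaks of regions instead of vertices, so that connectedness can be transferred between
   colorings that differ in name or by exchanging the colors. *)
Lemma checkerboard_connectedP b : connected (checkerboard_graph s b) <->
  (exists r, s r = b) /\ forall P : region D -> bool,
    (forall c, P (region_at b c false) = P (region_at b c true)) ->
    forall r r', s r = b -> s r' = b -> P r = P r'.
Proof.
split=> [[/card_gt0P[u _] con]|[[r sr] H]].
  split=> [|P Pe r r' sr sr']; first by exists (val u); apply/eqP/(valP u).
  have /connectP[p] := con (exist _ r (introT eqP sr)) (exist _ r' (introT eqP sr')).
  set x := exist _ r _; set y := exist _ r' _; rewrite -[P r]/(P (val x)) -[P r']/(P (val y)).
  move: x y => x y {r r' sr sr'}.
  elim: p x => [|z p IHp] x /= => [_ -> //|/andP[/existsP[c /eqP ce] pp] yl].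
  rewrite -(IHp _ pp yl) {pp yl IHp}; rewrite /= in ce.
  have [xc zc] : x \in crossing_ends s b c /\ z \in crossing_ends s b c.
    by rewrite ce !inE !eqxx orbT.
  move: xc zc; rewrite crossing_endsE !inE.
  by case/orP=> /eqP ->; case/orP=> /eqP -> /=; rewrite ?Pe.
split; first by apply/card_gt0P; exists (exist _ r (introT eqP sr)).
move=> x y.
pose P r := [exists u : vertex (checkerboard_graph s b), (val u == r) && connect (@adjacent (checkerboard_graph s b)) x u].
have PE u : P (val u) = connect (@adjacent (checkerboard_graph s b)) x u.
  apply/existsP/idP => [[v /andP[/eqP/val_inj ->]]//|h]; by exists u; rewrite eqxx.
have asym : connect_sym (@adjacent (checkerboard_graph s b)).
  by apply: sym_connect_sym => u v; apply: eq_existsb => e; rewrite setUC.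
have Pc c : P (region_at b c false) = P (region_at b c true).
  rewrite -[region_at b c false]/(val (colored_region_at b c false)).
  rewrite -[region_at b c true]/(val (colored_region_at b c true)) !PE.
  have adj : adjacent (G := checkerboard_graph s b) (colored_region_at b c false) (colored_region_at b c true).
    by apply/existsP; exists c; rewrite /= crossing_endsE.
  by rewrite ![connect _ x _]asym; apply: same_connect (connect1 adj) _.
have sv (u : vertex (checkerboard_graph s b)) : s (val u) = b by apply/eqP/(valP u).
by rewrite -PE -(H P Pc (val x) (val y)) // PE connect0.
Qed.

End Corners.

(** Crossing an arc or a circle changes both colors. *)
Lemma coloring_unique (D : link_diagram) (s s' : coloring D) :
  exists t, forall r, s' r = s r (+) t.
Proof.
exists (s (unbounded D) (+) s' (unbounded D)) => r.
suff H r' : s r' (+) s' r' = s (unbounded D) (+) s' (unbounded D).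
  by rewrite -(H r) addbA addbb.
have /connectP[p] := region_connected (unbounded D) r'.
elim: p (unbounded D) => [|z p IHp] u /= => [_ -> //|/andP[st pp] /(IHp _ pp) ->].
case/orP: st => [/existsP[h /andP[/eqP <- /eqP <-]]|/existsP[k /existsP[b /andP[/eqP <- /eqP <-]]]].
  have := shade_corner s h; have := shade_corner s' h.
  by do 2!case: (s (corner _)); do 2!case: (s' (corner _)).
have := shade_side s k; have := shade_side s' k.
by case: b; do 2!case: (s (side _ _)); do 2!case: (s' (side _ _)).
Qed.

Lemma coloring_connected (D : link_diagram) (s : coloring D) b :
  checkerboard_connected D -> connected (checkerboard_graph s b).
Proof.
case=> s0 con; have [t st] := coloring_unique s0 s.
have /checkerboard_connectedP[[r sr] H] := con (b (+) t).
apply/checkerboard_connectedP; split=> [|P Pe r1 r2 s1 s2].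
  by exists r; rewrite st sr -addbA addbb addbF.
have bt r0 : s r0 = b -> s0 r0 = b (+) t by rewrite st => <-; rewrite -addbA addbb addbF.
apply: H; [|exact: bt|exact: bt] => c; have := Pe c; rewrite /region_at st.
suff -> : (s0 (corner (c, ord0)) (+) t != b) = (s0 (corner (c, ord0)) != b (+) t) by [].
by move: (s0 _) t b {st sr s1 s2 bt Pe} => [] [] [].
Qed.

Section DiagramPair.

Variables (D : link_diagram) (s : coloring D) (b : bool).
Variables (X : finType) (th : X -> crossing D).
Hypotheses (con : checkerboard_connected D) (th_bij : bijective th) (e0 : X).

Let V := colored_region s b.
Let F := colored_region s (~~ b).
Let gV e x : V := colored_region_at s b (th e) x.
Let kF e x : F := colored_region_at s (~~ b) (th e) x.

Lemma colored_vertex_connected b' :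
  vertex_connected (fun e x => colored_region_at s b' (th e) x).
Proof.
have /checkerboard_connectedP[[r sr] H] := coloring_connected s b' con.
split; first by apply/card_gt0P; exists (exist _ r (introT eqP sr)).
move=> q q0 v v'; have [th' th'K thK'] := th_bij.
pose P r := [exists u : colored_region s b', (val u == r) && q u].
have PE u : P (val u) = q u.
  by apply/existsP/idP => [[w /andP[/eqP/val_inj ->]]//|qu]; exists u; rewrite eqxx.
have sv (u : colored_region s b') : s (val u) = b' by apply/eqP/(valP u).
rewrite -!PE; apply: H => // c; rewrite -[region_at s b' c false]/(val (colored_region_at s b' c false)).
rewrite -[region_at s b' c true]/(val (colored_region_at s b' c true)) !PE.
by have := q0 (th' c); rewrite /vertex_coboundary thK'; do 2!case: (q _).
Qed.

Lemma card_colored_regions : #|V| + #|F| = #|region D|.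
Proof.
rewrite /V /F !card_sig -(cardC [pred r : region D | s r == b]); congr (_ + _).
by apply: eq_card => r; rewrite !inE; case: (s r); case: (b).
Qed.

Lemma gV_kF_orthogonal q r :
  dot setT (vertex_coboundary gV q) (vertex_coboundary kF r) = false.
Proof.
have ext b' (q' : colored_region s b' -> bool) : exists P : region D -> bool,
    forall u, P (val u) = q' u.
  exists (fun r => [exists u : colored_region s b', (val u == r) && q' u]) => u.
  by apply/existsP/idP => [[w /andP[/eqP/val_inj ->]]//|qu]; exists u; rewrite eqxx.
have [q' qq'] := ext _ q; have [r' rr'] := ext _ r.
rewrite /dot -[RHS](region_orthogonal s b q' r') (reindex th) /=; last exact: onW_bij.
by apply: eq_big => e; rewrite ?inE // /vertex_coboundary -!qq' -!rr'.
Qed.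

Lemma every_region_has_corner (r : region D) : exists h, corner h = r.
Proof.
have [th' th'K thK'] := th_bij.
pose c0 := th e0; have [_ H] := colored_vertex_connected (s r).
case: (boolP [exists c, exists x, region_at s (s r) c x == r]).
  by case/existsP=> c /existsP[x /eqP <-]; eexists.
move=> /existsPn no; have nr c x : region_at s (s r) c x != r.
  by move/existsPn: (no c); apply.
have q0 e : vertex_coboundary (fun e x => colored_region_at s (s r) (th e) x)
    (fun u => val u == r) e = false.
  by rewrite /vertex_coboundary /= !(negPf (nr _ _)).
have := H _ q0 (colored_region_at s (s r) c0 false) (exist _ r (eqxx _)).
by rewrite /= eqxx (negPf (nr _ _)).
Qed.

Definition face_step := @next_cw (crossing D) \o @opp D.

Lemma face_step_inj : injective face_step.
Proof.
apply: inj_comp (inv_inj (@opp_involutive D)); exact: can_inj (@next_cwK (crossing D)).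
Qed.

Lemma corner_face_step (h : half_edge (crossing D)) : corner (face_step h) = corner h.
Proof. exact: corner_next. Qed.

(** Each region has at least one boundary curve, and orthogonality bounds the number of regions
   from above. In the Euler formula this leaves no circles and exactly one boundary curve for
   each region. *)
Lemma region_count : #|region D| = #|crossing D| + 2 /\
  forall h h' : half_edge (crossing D), corner h = corner h' -> fconnect face_step h h'.
Proof.
have [le2 one] := fcard_labels face_step_inj corner_face_step every_region_has_corner.
have Xc : #|X| = #|crossing D| by apply: bij_eq_card th_bij.
have le1 : #|region D| <= #|crossing D| + 2.
  rewrite -card_colored_regions -Xc; apply: orthogonal_card.
  - exact: colored_vertex_connected.
  - exact: colored_vertex_connected.
  - exact: gV_kF_orthogonal.
have eul := euler_sphere D; rewrite -/face_step in eul.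
by split; [lia|apply/one; lia].
Qed.

Lemma opp_region_at b' (h : half_edge (crossing D)) : exists x x',
  region_at s b' h.1 x = region_at s b' (opp h).1 x'.
Proof.
have cr h' : exists x, corner h' = region_at s (s (corner h')) h'.1 x.
  by case: h' => c i; exists (1 < i); apply: corner_region_at.
have e1 : corner (next_cw (opp h)) = corner h by apply: corner_next.
have e2 : corner (opp h) = corner (next_cw h).
  by rewrite -[in RHS](opp_involutive h) corner_next.
have d : s (corner (opp h)) != s (corner h).
  by have := shade_corner s (next_cw (opp h)); rewrite e1 eq_sym next_cwK.
have [x hx] := cr h; have [x' hx'] := cr (next_cw (opp h)).
have [y hy] := cr (opp h); have [y' hy'] := cr (next_cw h).
rewrite e1 in hx'; rewrite -e2 in hy'.
have [->|nb] := eqVneq b' (s (corner h)); first by exists x, x'; rewrite -hx -hx'.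
have -> : b' = s (corner (opp h)) by move: nb d; case: b'; do 2!case: (s _).
by exists y', y; rewrite -hy -hy'.
Qed.

Definition region_code (c : bool) (u : colored_region s c) : nat := enum_rank (val u).

Lemma region_code_inj c : injective (@region_code c).
Proof. by move=> u v /ord_inj/enum_rank_inj/val_inj. Qed.

Definition diagram_label c : labeling X :=
  fun e x => region_code (colored_region_at s c (th e) x).

(** All corners of a region lie on one boundary curve, and consecutive corners on it belong to
   the same crossing or to crossings joined by an arc, which touch. So a set of crossings
   closed under touching contains all crossings at a region with one of them, and hence all crossings. *)
Lemma diagram_planar : planar_pair setT (diagram_label b) (diagram_label (~~ b)).
Proof.
have [rX one] := region_count.
have Xc : #|X| = #|crossing D| by apply: bij_eq_card th_bij.
split.
  apply: label_planar; try exact: region_code_inj; try exact: colored_vertex_connected.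
    exact: gV_kF_orthogonal.
  by rewrite card_colored_regions Xc.
have [th' th'K thK'] := th_bij.
apply: linked_closed => C _ /set0Pn[a aC] cl.
pose inC (h : half_edge (crossing D)) := th' h.1 \in C.
have inC_opp h : inC h -> inC (opp h).
  move=> hC; apply: (cl _ _ hC); first by rewrite inE.
  have [x [x' ex]] := opp_region_at b h; have [y [y' ey]] := opp_region_at (~~ b) h.
  apply/touchP; exists x, y, x', y'.
  by rewrite /diagram_label /region_code /= !thK' ex ey.
have inC_conn h h' : fconnect face_step h h' -> inC h -> inC h'.
  case/connectP=> p pp ->; elim: p h pp => //= z p IHp h /andP[/eqP <-] /IHp H hC.
  by apply: H; apply: inC_opp hC.
pose P r := [exists h, inC h && (corner h == r)].
have PE h : P (corner h) = inC h.
  apply/existsP/idP => [[h' /andP[h'C /eqP hh']]|hC]; last by exists h; rewrite hC eqxx.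
  exact: inC_conn (one _ _ hh') h'C.
have /checkerboard_connectedP[_ H] := coloring_connected s b con.
apply/setP=> e; rewrite inE.
have Pr c x : P (region_at s b c x) = (th' c \in C) by rewrite PE.
have := H P _ _ _ (shade_region_at s b (th e) false) (shade_region_at s b (th a) false).
by rewrite !Pr !th'K aC; apply => c; rewrite !Pr.
Qed.

Lemma diagram_depicts c :
  depicts (G := checkerboard_graph s c) th (diagram_label c)
    (fun e => crossing_sign s c (th e)).
Proof.
split=> //; exists (fun e x => colored_region_at s c (th e) x); split=> //.
- by move=> e; apply: crossing_endsE.
- by move=> e x e' x'; rewrite (inj_eq (@region_code_inj c)).
- move=> u; have [[c0 i] ci] := every_region_has_corner (val u).
  have [th' th'K thK'] := th_bij; exists (th' c0), (1 < i).
  apply/val_inj; rewrite /= thK' -ci [LHS](corner_region_at s) ci.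
  by rewrite (eqP (valP u)).
Qed.

End DiagramPair.

(** * Pairs of perfect matchings *)

Section Matchings.

Variable T : finType.

Definition matching (a : T -> T) := involutive a /\ forall x, a x != x.

Definition alternate (a b : T -> T) : rel T := fun x y => (a x == y) || (b x == y).

Lemma alternate_sym a b : matching a -> matching b -> connect_sym (alternate a b).
Proof.
move=> [aK _] [bK _]; apply: sym_connect_sym => x y; rewrite /alternate.
by rewrite (can2_eq aK aK) (can2_eq bK bK) ![x == _]eq_sym.
Qed.

Lemma step_inj (a b : T -> T) : matching a -> matching b -> injective (b \o a).
Proof. by move=> [aK _] [bK _]; apply: inj_comp; apply: inv_inj. Qed.

(** A point and its partner are never in the same orbit: a shortest such orbit segment could be
   shortened at both ends. *)
Lemma iter_alternate_neq (a b : T -> T) n x : matching a -> matching b ->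
  iter n (b \o a) x != a x.
Proof.
move=> [aK aN] [bK bN]; elim/ltn_ind: n x => -[|[|n]] IHn x.
- by rewrite eq_sym aN.
- exact: bN.
rewrite iterS iterSr /=; apply/negP=> /eqP e.
have {}e : iter n (b \o a) (b (a x)) = a (b (a x)).
  by rewrite -[LHS]aK -[X in a X]bK e.
by move: (IHn n (ltnW (ltnSn _)) (b (a x))); rewrite e eqxx.
Qed.

Lemma fconnect_alternate_neq (a b : T -> T) x : matching a -> matching b ->
  ~~ fconnect (b \o a) x (a x).
Proof.
move=> ma mb; apply/negP => /iter_findex e.
by have := iter_alternate_neq (findex (b \o a) x (a x)) x ma mb; rewrite e eqxx.
Qed.

(** The union of two perfect matchings consists of even cycles. Each cycle contains two orbits of
   [b \o a], exchanged by both matchings; one of them is selected by its representative. *)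
Lemma alternate_coloring (a b : T -> T) : matching a -> matching b ->
  exists o : T -> bool, forall x, o (a x) = ~~ o x /\ o (b x) = ~~ o x.
Proof.
move=> ma mb; have [[aK aN] [bK bN]] := (ma, mb).
have fs := fconnect_sym (step_inj ma mb).
pose rt x := enum_rank (froot (b \o a) x).
have rtE x y : fconnect (b \o a) x y -> rt x = rt y.
  by rewrite /rt => /(rootP fs) ->.
have oa x : (rt (a x) < rt (a (a x))) = ~~ (rt x < rt (a x)).
  rewrite aK -leqNgt ltn_neqAle; suff -> : nat_of_ord (rt (a x)) != rt x by [].
  rewrite (inj_eq val_inj) (inj_eq enum_rank_inj) (sameP eqP (rootP fs)) fs.
  exact: fconnect_alternate_neq.
exists (fun x => rt x < rt (a x)) => x; split; first exact: oa.
have -> : rt (b x) = rt (a x).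
  by apply/esym/rtE/connect1; rewrite /= aK eqxx.
have -> : rt (a (b x)) = rt x by apply/rtE/connect1; rewrite /= aK bK eqxx.
by rewrite -oa aK.
Qed.

(** Reconnecting two edges [x1 -- a x1] and [x2 -- a x2] of a matching. *)
Definition reconnect (a : T -> T) x1 x2 := fun x =>
  if x == x1 then x2 else if x == x2 then x1
  else if x == a x1 then a x2 else if x == a x2 then a x1 else a x.

Lemma reconnectE1 a x1 x2 : reconnect a x1 x2 x1 = x2.
Proof. by rewrite /reconnect eqxx. Qed.

Lemma reconnect_matching a x1 x2 : matching a -> x1 != x2 -> x2 != a x1 ->
  matching (reconnect a x1 x2).
Proof.
move=> [aK aN] n12 n2a1.
have n1a2 : x1 != a x2 by rewrite -(inj_eq (inv_inj aK)) aK eq_sym.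
have na : a x1 != a x2 by rewrite (inj_eq (inv_inj aK)).
have [n1 n2] := (aN x1, aN x2).
split=> x; rewrite /reconnect.
  case: (eqVneq x x1) => [->|xn1]; first by rewrite eq_sym (negPf n12) eqxx.
  case: (eqVneq x x2) => [->|xn2]; first by rewrite eqxx.
  case: (eqVneq x (a x1)) => [->|xn3].
    rewrite [a x2 == x1]eq_sym (negPf n1a2) (negPf n2) [a x2 == a x1]eq_sym (negPf na).
    by rewrite eqxx.
  case: (eqVneq x (a x2)) => [->|xn4].
    by rewrite (negPf n1) [a x1 == x2]eq_sym (negPf n2a1) eqxx.
  rewrite !(inv_eq aK) (negPf xn3) (negPf xn4) !aK.
  by rewrite (negPf xn1) (negPf xn2).
case: (eqVneq x x1) => [->|xn1]; first by rewrite eq_sym.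
case: (eqVneq x x2) => [->|xn2] //.
case: (eqVneq x (a x1)) => [->|xn3]; first by rewrite eq_sym.
by case: (eqVneq x (a x2)) => [->|xn4].
Qed.

(** Travelling along the cycle from [a x1] away from the removed edge, one meets [x1] or [x2],
   which are now joined, before [a x2]; so the ends of each removed edge stay connected. *)
Lemma reconnect_connect a b x1 x2 : matching a -> matching b -> x1 != x2 -> x2 != a x1 ->
  ~~ fconnect (b \o a) x1 (a x2) ->
  subrel (connect (alternate a b)) (connect (alternate (reconnect a x1 x2) b)).
Proof.
move=> ma mb n12 n2a1 nf; have ma' := reconnect_matching ma n12 n2a1.
have [[aK aN] [bK bN]] := (ma, mb).
set a' := reconnect a x1 x2 in ma' *; set C := connect (alternate a' b).
have csym : connect_sym (alternate a' b) by apply: alternate_sym.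
have Ca x : C x (a' x) by apply: connect1; rewrite /alternate eqxx.
have Cb x : C x (b x) by apply: connect1; rewrite /alternate eqxx orbT.
have C12 : C x1 x2 by rewrite -[x2](reconnectE1 a x1 x2); apply: Ca.
have Caa : C (a x1) (a x2).
  have <- : a' (a x1) = a x2; last exact: Ca.
  by rewrite /a' /reconnect (negPf (aN x1)) [a x1 == x2]eq_sym (negPf n2a1) eqxx.
have Cx1 : C x1 (a x1).
  have ex : exists n, (0 < n) && (iter n (b \o a) x1 \in [:: x1; x2]).
    exists (order (b \o a) x1); rewrite order_gt0 iter_order ?inE ?eqxx //.
    exact: step_inj.
  case: (ex_minnP ex) => n /andP[n0 hn] nmin.
  have walk i : 0 < i <= n -> C (a x1) (iter i (b \o a) x1).
    elim: i => // -[_ _|i IHi /andP[_ lt]]; first exact: Cb.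
    apply: connect_trans (IHi _) _; first exact: ltnW.
    rewrite [iter i.+2 _ _]iterS; set y := iter i.+1 _ _; change (C y (b (a y))).
    have yN : y \notin [:: x1; x2].
      by apply/negP => hy; have := nmin i.+1; rewrite hy => /(_ isT); rewrite leqNgt lt.
    have y1 : y != a x1 by apply: iter_alternate_neq.
    have y2 : y != a x2 by apply: contra nf => /eqP <-; apply: fconnect_iter.
    have <- : a' y = a y.
      by move: yN; rewrite /a' /reconnect !inE (negPf y1) (negPf y2); do 2!case: (y == _).
    by apply: connect_trans (Ca y) (Cb _).
  have := walk n; rewrite n0 leqnn => /(_ isT).
  move: hn; rewrite !inE => /orP[] /eqP ->; rewrite /C csym // => h.
  exact: connect_trans C12 h.
have Cx2 : C x2 (a x2).
  by apply: connect_trans (connect_trans Cx1 Caa); rewrite /C csym.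
have Cxa x : C x (a x).
  have := Ca x; rewrite /a' /reconnect.
  case: (eqVneq x x1) => [->|xn1]; first by [].
  case: (eqVneq x x2) => [->|xn2]; first by [].
  case: (eqVneq x (a x1)) => [-> _|xn3]; first by rewrite aK /C csym; apply: Cx1.
  by case: (eqVneq x (a x2)) => [-> _|xn4] //; rewrite aK /C csym; apply: Cx2.
move=> x y; apply: connect_sub => {}x {}y /orP[/eqP <-|/eqP <-]; [exact: Cxa|exact: Cb].
Qed.

Lemma alternate_fconnect a b (o : T -> bool) x y : matching a -> matching b ->
  (forall x, o (a x) = ~~ o x) -> (forall x, o (b x) = ~~ o x) ->
  connect (alternate a b) x y -> o x = o y -> fconnect (b \o a) x y.
Proof.
move=> ma mb oa ob; have [[aK aN] [bK bN]] := (ma, mb).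
have fs := fconnect_sym (step_inj ma mb).
have f1 z : fconnect (b \o a) z (b (a z)) by apply: connect1; rewrite /= eqxx.
case/connectP=> p pp ->.
have : fconnect (b \o a) x (if o x == o (last x p) then last x p else a (last x p)).
  elim/last_ind: p pp => [_|p z IHp]; first by rewrite /= eqxx.
  rewrite rcons_path last_rcons => /andP[/IHp + /orP[] /eqP <-];
    rewrite ?oa ?ob; set y' := last x p; case: (o x); case: (o y') => //= h; rewrite ?aK //.
  - by apply: connect_trans h _; rewrite fs -{2}(bK y') -{2}(aK (b y')).
  - by apply: connect_trans h _; rewrite -{2}(aK y').
  - by apply: connect_trans h _; rewrite -{2}(aK y').
  - by apply: connect_trans h _; rewrite fs -{2}(bK y') -{2}(aK (b y')).
by case: eqP.
Qed.

End Matchings.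

(** * Gluing quadrilaterals along their sides *)

Section Maximal.

Variables (T : finType) (L : eqType).

Definition pairing (l1 l2 : T -> L) (t : T -> T) :=
  [/\ matching t, forall h, l1 (t h) = l1 h & forall h, l2 (t h) = l2 h].

(** Whatever the gluing of sides with equal labels, regluing can bring together all sides with
   a given first label: they cannot be divided in two parts closed under [n1] and under
   equality of both labels. *)
Definition star_connected (l1 l2 : T -> L) (n1 : T -> T) := forall R : pred T,
  (forall h, R h -> R (n1 h)) ->
  (forall h h', R h -> l1 h = l1 h' -> l2 h = l2 h' -> R h') ->
  forall h h', l1 h = l1 h' -> R h -> R h'.

Definition alternate_pairs (t n : T -> T) := #|[set p : T * T | connect (alternate t n) p.1 p.2]|.

Definition one_cycle (l : T -> L) (t n : T -> T) :=
  forall h h', l h = l h' -> connect (alternate t n) h h'.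

Lemma pairingC l1 l2 t : pairing l1 l2 t -> pairing l2 l1 t.
Proof. by case. Qed.

(** If the sides with some label lie on two cycles, then two of them have the same labels and
   can be reglued. This merges the two cycles for [n1]. There are two ways of regluing, and at
   least one of them breaks no cycle for [n2]. *)
Lemma merge_cycles l1 l2 n1 n2 t : matching n1 -> matching n2 ->
  star_connected l1 l2 n1 -> pairing l1 l2 t ->
  one_cycle l1 t n1 \/ exists2 t', pairing l1 l2 t' &
    alternate_pairs t n1 + alternate_pairs t n2 <
    alternate_pairs t' n1 + alternate_pairs t' n2.
Proof.
move=> m1 m2 st [mt t1 t2]; have [tK tN] := mt.
case: (boolP [forall h, forall h', (l1 h == l1 h') ==> connect (alternate t n1) h h']).
  by move=> /forallP oc; left=> h h' /eqP hh'; move/forallP/(_ h')/implyP: (oc h); apply.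
rewrite negb_forall => /existsP[h]; rewrite negb_forall => /existsP[h'].
rewrite negb_imply => /andP[/eqP hh' nc]; right.
pose R := connect (alternate t n1) h.
have [x1 [x2 [R1 R2 e1 e2]]] : exists x1 x2, [/\ R x1, ~~ R x2, l1 x1 = l1 x2 & l2 x1 = l2 x2].
  case: (boolP [exists p : T * T, [&& R p.1, ~~ R p.2, l1 p.1 == l1 p.2 & l2 p.1 == l2 p.2]]).
    by case/existsP=> p /and4P[? ? /eqP ? /eqP ?]; exists p.1, p.2.
  move=> /existsPn no; case/negP: nc; apply: (st R) hh' (connect0 _ _).
    by move=> x Rx; apply: connect_trans Rx (connect1 _); rewrite /alternate eqxx orbT.
  move=> x y Rx xy1 xy2; apply: contraT => nR; case/negP: (no (x, y)).
  by rewrite /= nR Rx xy1 xy2 !eqxx.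
have Rt x : R (t x) = R x.
  have Rt' y : R y -> R (t y).
    by move=> Ry; apply: connect_trans Ry (connect1 _); rewrite /alternate eqxx.
  by apply/idP/idP => /Rt'; rewrite ?tK.
have [y [Ry ey1 ey2 nf]] : exists y, [/\ ~~ R y, l1 x1 = l1 y, l2 x1 = l2 y
    & ~~ fconnect (n2 \o t) x1 (t y)].
  case: (boolP (fconnect (n2 \o t) x1 (t x2))) => f; last by exists x2.
  exists (t x2); rewrite Rt t1 t2 tK; split=> //.
  have fs := fconnect_sym (step_inj mt m2); apply/negP => f'.
  case/negP: (fconnect_alternate_neq x2 mt m2).
  by apply: connect_trans f; rewrite fs.
have n12 : x1 != y by apply: contraNneq Ry => <-.
have n2a : y != t x1 by apply: contraNneq Ry => ->; rewrite Rt.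
have sub1 := reconnect_connect mt m1 n12 n2a.
have sub2 := reconnect_connect mt m2 n12 n2a nf.
have {}sub1 : subrel (connect (alternate t n1)) (connect (alternate (reconnect t x1 y) n1)).
  apply: sub1; apply: contra Ry => f; rewrite -(Rt y).
  apply: connect_trans R1 _; apply: connect_sub f => u v /eqP <- /=.
  apply: (@connect_trans _ _ (t u)); apply: connect1; rewrite /alternate eqxx ?orbT //.
exists (reconnect t x1 y).
  split; first exact: reconnect_matching.
    by move=> x; rewrite /reconnect; do 4?[case: eqVneq => [->|_]]; rewrite ?t1.
  by move=> x; rewrite /reconnect; do 4?[case: eqVneq => [->|_]]; rewrite ?t2.
rewrite -addSn; apply: leq_add; last first.
  by apply/subset_leq_card/subsetP=> p; rewrite !inE => /sub2.
apply/proper_card/properP; split.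
  by apply/subsetP=> p; rewrite !inE => /sub1.
exists (x1, y); rewrite !inE /=.
  by apply: connect1; rewrite /alternate reconnectE1 eqxx.
apply: contra Ry; exact: connect_trans.
Qed.

Lemma one_cycle_pairing l1 l2 n1 n2 t : matching n1 -> matching n2 ->
  star_connected l1 l2 n1 -> star_connected l2 l1 n2 -> pairing l1 l2 t ->
  exists t', [/\ pairing l1 l2 t', one_cycle l1 t' n1 & one_cycle l2 t' n2].
Proof.
move=> m1 m2 st1 st2.
have bnd u n : alternate_pairs u n <= #|{: T * T}| by apply: max_card.
pose mu u := #|{: T * T}| + #|{: T * T}| - (alternate_pairs u n1 + alternate_pairs u n2).
move: {2}(mu t) (leqnn (mu t)) => n.
have up u v : alternate_pairs u n1 + alternate_pairs u n2 <
    alternate_pairs v n1 + alternate_pairs v n2 -> mu v < mu u.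
  have := (bnd u n1, bnd u n2, bnd v n1, bnd v n2); rewrite /mu.
  move: (alternate_pairs u n1) (alternate_pairs u n2) (alternate_pairs v n1) (alternate_pairs v n2) #|_|.
  by move=> a b c d e [[[]]]; lia.
elim/ltn_ind: n t => n IHn t tn pt.
have [oc1|[t' pt' lt]] := merge_cycles m1 m2 st1 pt; last first.
  by apply: (IHn (mu t')) => //; apply: leq_trans (up _ _ lt) tn.
have [oc2|[t' pt' lt]] := merge_cycles m2 m1 st2 (pairingC pt); last first.
  apply: (IHn (mu t')) => //; last exact: pairingC.
  by apply: leq_trans tn; apply: up; rewrite addnC [X in _ < X]addnC.
by exists t.
Qed.

End Maximal.

(** * Realization of planar pairs by diagrams *)

Section Sides.

Variable X : finType.

Implicit Types (g k : labeling X) (h : quad_side X).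

Definition across1 h : quad_side X := (h.1.1, h.1.2, ~~ h.2).
Definition across2 h : quad_side X := (h.1.1, ~~ h.1.2, h.2).

Lemma across1_matching : matching across1.
Proof. by split=> -[[e x] y]; rewrite /across1 /= ?negbK // !xpair_eqE eqxx; case: y; rewrite andbF. Qed.

Lemma across2_matching : matching across2.
Proof. by split=> -[[e x] y]; rewrite /across2 /= ?negbK // !xpair_eqE eqxx; case: x. Qed.

Definition label1 g h := g h.1.1 h.1.2.
Definition label2 k h := k h.1.1 h.2.

(** Let [R] be a closed part of the sides at the vertex [v]. Its edges form a set [w] orthogonal
   to the cuts of [k], hence the cut of some [p]. The function [P] that is [R] at [v] and [p],
   normalized by its value at [v], elsewhere is then constant on each quadrilateral and on
   sides with equal labels; so it is constant, and [R] has no side at [v] or all of them. *)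
Lemma planar_star_connected g k : planar_pair setT g k ->
  star_connected (label1 g) (label2 k) across1.
Proof.
move=> [[o d _] lk] R R1 R2 h0 h0' hh0; pose v := label1 g h0.
have R1E e x y : R (e, x, y) = R (e, x, false).
  by apply/idP/idP => /R1; rewrite /across1 /=; case: y => // /R1; rewrite /across1.
pose S h := (label1 g h == v) && R h.
pose w e := S (e, false, false) (+) S (e, true, false).
have [p wp] : cut setT g w.
  apply: d => r; have [t [tK tN _ tg tk]] := side_pairing o.
  transitivity (\big[addb/false]_h (S h && r (label2 k h))); last first.
    apply: (xor_invariant tK) => // h _; first by apply: tN; rewrite inE.
    rewrite /S /label1 /label2 tg tk; congr (_ && _ && _).
    by apply/idP/idP => Rh; apply: R2 Rh _ _; rewrite /label1 /label2 ?tg ?tk.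
  transitivity (\big[addb/false]_e \big[addb/false]_(x : bool) \big[addb/false]_(y : bool)
    (S (e, x, y) && r (label2 k (e, x, y)))); last first.
    by rewrite pair_big /= pair_big /=; apply: eq_bigr => -[[e x] y].
  rewrite /dot (eq_bigl xpredT) => [|e]; last by rewrite inE.
  apply: eq_bigr => e _; rewrite !big_bool /w /coboundary /S /label1 /label2 /= !(R1E _ _ true).
  by do 2![case: (_ == v)]; do 2![case: (R _)]; do 2![case: (r _)].
pose P h := if label1 g h == v then R h else p (label1 g h) (+) p v.
have PE e x y : P (e, x, y) = S (e, x, false) (+) p (g e x) (+) p v.
  rewrite /P /S /label1 /= R1E; case: eqP => [->|_] /=; last by [].
  by rewrite -addbA addbb addbF.
have Pe e x y x' y' : P (e, x, y) = P (e, x', y').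
  have := wp e (in_setT _); rewrite !PE /w /coboundary.
  by case: x; case: x' => //; do 2![case: (S _)]; do 2![case: (p (g _ _))].
have PP e e' x y x' y' : P (e, x, y) = P (e', x', y').
  suff H : forall x' y', P (e, x, y) = P (e', x', y') by [].
  apply: (linked_ind (P := fun e' => forall x' y', P (e, x, y) = P (e', x', y')) lk _
    (in_setT e) (in_setT e')) => [|x1 y1]; last exact: Pe.
  move=> a b _ _ /touchP[x1 [y1 [x2 [y2 [eg ek]]]]] IH x3 y3.
  rewrite (IH x1 y1) (Pe b x3 y3 x2 y2) /P /label1 /= eg.
  case: ifP => // _; apply/idP/idP => Rh; apply: R2 Rh _ _; by rewrite /label1 /label2 /= ?eg ?ek.
move=> Rh; have := PP h0.1.1 h0'.1.1 h0.1.2 h0.2 h0'.1.2 h0'.2.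
move: hh0 Rh; rewrite /P /v /label1; case: h0 h0' {v S w wp P PE Pe PP} => [[e x] y] [[e' x'] y'] /= <-.
by rewrite eqxx => ->.
Qed.

(** The quadrilaterals around each vertex can be oriented coherently, which is [o1]. The edges
   [w] along which these choices disagree meet the boundary of each face evenly; hence they
   form a cut, and the orientations at the vertices on one side of it are reversed. *)
Lemma planar_orientation g k t : abstract_dual setT g k -> pairing (label1 g) (label2 k) t ->
  exists o : quad_side X -> bool, [/\ forall h, o (t h) = ~~ o h,
    forall h, o (across1 h) = ~~ o h & forall h, o (across2 h) = ~~ o h].
Proof.
move=> [_ d _] [mt t1 t2]; have [tK tN] := mt.
have [o1 o1E] := alternate_coloring mt across1_matching.
have o1t h : o1 (t h) = ~~ o1 h by have [] := o1E h.
have o1y e x y : o1 (e, x, y) = o1 (e, x, false) (+) y.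
  by case: y; rewrite ?addbF // -[(e, x, true)]/(across1 (e, x, false)) (o1E _).2 addbT.
pose w e := ~~ (o1 (e, false, false) (+) o1 (e, true, false)).
have [p wp] : cut setT g w.
  apply: d => r.
  (* Both [o1], by the gluing, and the choice of an end, by the reflection, halve the set of sides at the given faces. *)
  pose Q (f : pred (quad_side X)) := #|[set h | r (label2 k h) && f h]|.
  have half (f : pred (quad_side X)) (u : quad_side X -> quad_side X) : involutive u ->
      (forall h, label2 k (u h) = label2 k h) -> (forall h, f (u h) = ~~ f h) ->
      Q f + Q f = #|[set h | r (label2 k h)]|.
    move=> uK ul fu; rewrite -(cardsID [set h | f h]); congr (_ + _).
      by apply: eq_card => h; rewrite !inE.
    rewrite /Q -(card_imset [set h | r (label2 k h) && f h] (inv_inj uK)); apply: eq_card => h; rewrite !inE.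
    apply/imsetP/idP => [[h']|/andP[nf rh]].
      by rewrite inE => /andP[rh fh] ->; rewrite ul rh fu fh.
    by exists (u h); rewrite ?uK // inE ul rh fu nf.
  have QQ : Q o1 = Q (fun h => h.1.2).
    have := half _ _ tK t2 o1t.
    have := half (fun h => h.1.2) across2 across2_matching.1 (fun h => erefl) (fun h => erefl).
    by lia.
  have QE f : odd (Q f) = \big[addb/false]_e \big[addb/false]_(x : bool) \big[addb/false]_(y : bool)
      (r (k e y) && f (e, x, y)).
    rewrite /Q cardsE -xor_card.
    rewrite [LHS](eq_bigl (fun h => r (label2 k h) && f h)) => [|h]; last by [].
    rewrite big_mkcond pair_big /= pair_big /=; apply: eq_bigr => -[[e x] y] _ /=.
    by case: ifP.
  have := congr1 odd QQ; rewrite !QE => eqQ.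
  rewrite -[RHS](addbb (\big[addb/false]_e \big[addb/false]_(x : bool) \big[addb/false]_(y : bool)
      (r (k e y) && o1 (e, x, y)))) {2}eqQ -big_split.
  rewrite /dot (eq_bigl xpredT) => [|e]; last by rewrite inE.
  apply: eq_bigr => e _; rewrite !big_bool /= !(o1y e _ true) /w /coboundary.
  by do 2![case: (r _)]; do 2![case: (o1 _)].
have o2 : forall h, o1 (across2 h) (+) p (label1 g (across2 h)) = ~~ (o1 h (+) p (label1 g h)).
  move=> [[e x] y]; rewrite /across2 /label1 /= !(o1y e _ y).
  have := wp e (in_setT _); rewrite /w /coboundary.
  by case: x => /=; case: y; do 2![case: (o1 _)]; do 2![case: (p _)].
exists (fun h => o1 h (+) p (label1 g h)); split=> // h.
  by rewrite t1 o1t addNb.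
by rewrite (o1E h).2 addNb.
Qed.

(** A side becomes a half-edge. The corner following it counterclockwise is a vertex of the first
   graph if [o] holds and of the second one otherwise; [s0] tells which of them follows the
   overpassing half-edge 0, as the sign of the crossing requires. *)
Lemma side_order (o : quad_side X -> bool) (s0 : X -> bool) :
  (forall h, o (across1 h) = ~~ o h) -> (forall h, o (across2 h) = ~~ o h) ->
  exists (be : half_edge X -> quad_side X) (ga : quad_side X -> half_edge X),
    [/\ cancel be ga, cancel ga be, forall h : half_edge X, (be h).1.1 = h.1,
        forall h : half_edge X, be (next_ccw h) = if o (be h) then across1 (be h) else across2 (be h)
      & forall c, o (be (c, ord0)) = s0 c].
Proof.
move=> oa1 oa2; pose y0 c := o (c, false, false) (+) s0 c.
pose be (h : half_edge X) : quad_side X :=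
  let mid := (h.2 == 1 :> nat) || (h.2 == 2 :> nat) in let hi := 1 < h.2 in
  if s0 h.1 then (h.1, hi, y0 h.1 (+) mid) else (h.1, mid, y0 h.1 (+) hi).
pose ga (h : quad_side X) : half_edge X :=
  let: (c, x, y) := h in let y' := y (+) y0 c in
  let: (u, w) := if s0 c then (x, y') else (y', x) in
  (c, inord (if u then 3 - w else w)).
have oE c x y : o (c, x, y) = o (c, false, false) (+) x (+) y.
  have oy z : o (c, z, y) = o (c, z, false) (+) y.
    by case: y; rewrite ?addbF // -[(c, z, true)]/(across1 (c, z, false)) oa1 addbT.
  rewrite oy; case: x; rewrite ?addbF //.
  by rewrite -[(c, true, false)]/(across2 (c, false, false)) oa2 addbT.
exists be, ga; split.
- case=> c i; rewrite /be /ga /=; case s0c: (s0 c); rewrite ?s0c addbAC addbb addFb;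
    congr (_, _); apply/val_inj; case: i => [[|[|[|[|i]]]] lt] //=; by rewrite inordK.
- move=> [[c x] y]; have [z ->] : exists z, y = z (+) y0 c by exists (y (+) y0 c); rewrite addbK.
  rewrite /be /ga addbK; case s0c: (s0 c); case: x => /=; case: z;
    by rewrite /= s0c inordK //= addbC.
- by move=> h; rewrite /be; case: ifP.
- move=> [c i]; have st : o (be (c, i)) = s0 c (+) odd i.
    rewrite /be /=; case: i => [[|[|[|[|i]]]] lt] //; case s0c: (s0 c); rewrite oE /y0 s0c /=;
    by case: (o _).
  rewrite st; rewrite /be /next_ccw /=; case: i {st} => [[|[|[|[|i]]]] lt] //=;
  by case: (s0 c); rewrite /across1 /across2 /= ?modnn ?modn_small //= ?addbF ?addbT ?negbK.
- move=> c; rewrite /be /=; case s0c: (s0 c); rewrite oE /y0 s0c /=; by case: (o _).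
Qed.

End Sides.

Lemma depicts_connected (X : finType) (G : sgraph) (th : X -> edge G) g k sg : X ->
  depicts th g sg -> linked setT g k -> connected G.
Proof.
move=> e0 [_ [rg [eg pg sug _]]] lk.
split; first by apply/card_gt0P; exists (rg e0 false).
move=> u v; have [e [x ->]] := sug u; have [e' [x' ->]] := sug v.
have adj a z z' : connect (@adjacent G) (rg a z) (rg a z').
  have ad : adjacent (rg a false) (rg a true) by apply/existsP; exists (th a); rewrite eg.
  have ad' : adjacent (rg a true) (rg a false) by apply/existsP; exists (th a); rewrite eg setUC.
  by case: z; case: z'; rewrite ?connect0 ?connect1.
suff H : forall x', connect (@adjacent G) (rg e x) (rg e' x') by [].
apply: (linked_ind (P := fun e' => forall x', connect (@adjacent G) (rg e x) (rg e' x')) lk _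
  (in_setT e) (in_setT e')) => [|x1]; last exact: adj.
move=> a b _ _ /touchP[x1 [y1 [x2 [y2 [/eqP eab _]]]]] IH x3.
apply: connect_trans (IH x1) _; move: eab; rewrite -pg => /eqP ->; exact: adj.
Qed.

Lemma label_type (X : finType) (g : labeling X) : exists (V : finType) (gV : X -> bool -> V) (i : V -> nat),
  [/\ injective i, forall e x, i (gV e x) = g e x & forall v, exists e x, v = gV e x].
Proof.
pose s := [seq g p.1 p.2 | p : X * bool].
have ms e x : g e x \in s by apply/codomP; exists (e, x).
exists (seq_sub s), (fun e x => SeqSub (ms e x)), (@ssval _ s); split=> //.
  exact: val_inj.
by move=> [n ns]; have /codomP[[e x] /= ne] := ns; exists e, x; apply/val_inj.
Qed.

Section Realization.

Variables (X : finType) (e0 : X) (g k : labeling X) (sg : X -> bool).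
Hypothesis pgk : planar_pair setT g k.

Lemma vertex_connected_label (V : finType) (gV : X -> bool -> V) (i : V -> nat) l l' :
  planar_pair setT l l' ->
  injective i -> (forall e x, i (gV e x) = l e x) -> (forall v, exists e x, v = gV e x) ->
  vertex_connected gV.
Proof.
move=> [_ lk] iI ig gs; split; first by apply/card_gt0P; exists (gV e0 false).
move=> q q0 v v'; have [e [x ->]] := gs v; have [e' [x' ->]] := gs v'.
have qe a z z' : q (gV a z) = q (gV a z').
  by have := q0 a; rewrite /vertex_coboundary; case: z; case: z' => //; do 2![case: (q _)].
suff H : forall x', q (gV e x) = q (gV e' x') by [].
apply: (linked_ind (P := fun e' => forall x', q (gV e x) = q (gV e' x')) lk _
  (in_setT e) (in_setT e')) => [|x1]; last exact: qe.
move=> a b _ _ /touchP[x1 [y1 [x2 [y2 [eab _]]]]] IH x3.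
by rewrite (IH x1) (qe b x3 x2); congr q; apply: iI; rewrite !ig.
Qed.

(** The diagram is obtained by gluing the quadrilaterals to a sphere: sides are half-edges, and
   glued sides form an arc. Labels are regions, each of which has one boundary curve since the
   sides with a given label form one cycle; the Euler formula then follows from duality. *)
Theorem realization : exists (D : link_diagram) (s : coloring D) (th : X -> crossing D),
  [/\ checkerboard_connected D,
      depicts (G := checkerboard_graph s true) th g sg &
      depicts (G := checkerboard_graph s false) th k (fun e => ~~ sg e)].
Proof.
have [V [gV [iV [iVI iVg gVs]]]] := label_type g.
have [F [kF [iF [iFI iFk kFs]]]] := label_type k.
have [dl lk] := pgk; have [o d d'] := dl.
have cV : vertex_connected gV := vertex_connected_label pgk iVI iVg gVs.
have cF : vertex_connected kF := vertex_connected_label (planar_pairC pgk) iFI iFk kFs.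
have orth q r : dot setT (vertex_coboundary gV q) (vertex_coboundary kF r) = false.
  have ext (T : finType) (i : T -> nat) (p : T -> bool) : injective i -> exists p', forall v, p' (i v) = p v.
    move=> iI; exists (fun n => [exists v, (i v == n) && p v]) => v.
    by apply/existsP/idP => [[u /andP[/eqP/iI ->]]//|pv]; exists v; rewrite eqxx.
  have [q' qq'] := ext _ _ q iVI; have [r' rr'] := ext _ _ r iFI.
  rewrite -(o q' r'); apply: eq_dot => e _; rewrite /vertex_coboundary /coboundary.
    by rewrite -!iVg !qq'.
  by rewrite -!iFk !rr'.
have euler : #|V| + #|F| = #|X| + 2.
  apply: cut_euler cV cF orth _ => w ow.
  have [r|q wq] := d w; last by exists (fun v => q (iV v)) => e; rewrite wq ?inE // /vertex_coboundary !iVg.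
  rewrite -(ow (fun v => r (iF v))); apply: eq_dot => // e _.
  by rewrite /vertex_coboundary /coboundary !iFk.
have [t0 pt0] : exists t, pairing (label1 g) (label2 k) t.
  have [t [tK tN _ tg tk]] := side_pairing o; exists t; split=> //; split=> // h.
  by apply: tN; rewrite inE.
have [m1 m2] := (across1_matching X, across2_matching X).
have st1 := planar_star_connected pgk.
have st2 : star_connected (label2 k) (label1 g) (@across2 X).
  have sw := planar_star_connected (planar_pairC pgk).
  pose u (h : quad_side X) : quad_side X := (h.1.1, h.2, h.1.2).
  have uK : involutive u by case=> [[]].
  move=> R R1 R2 h h' hh' Rh.
  have := sw (R \o u) _ _ (u h) (u h') hh'; rewrite /= !uK; apply => // [x|x y Rx xy1 xy2].
    exact: R1 (u x).
  exact: (R2 (u x) (u y) Rx xy1 xy2).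
have [t [pt oc1 oc2]] := one_cycle_pairing m1 m2 st1 st2 pt0.
have [c [ct c1 c2]] := planar_orientation dl pt.
have [be [ga [beK gaK be1 be_next be0]]] := side_order (fun e => ~~ sg e) c1 c2.
have [[tK tN] t1 t2] := pt.
pose reg (h : quad_side X) : (V + F)%type := if c h then inl (gV h.1.1 h.1.2) else inr (kF h.1.1 h.2).
pose cor h := reg (be h).
pose op h := ga (t (be h)).
have be_op h : be (op h) = t (be h) by rewrite /op gaK.
have opK : involutive op by move=> h; rewrite {1}/op be_op tK beK.
have opN h : op h != h.
  by apply: contraNneq (tN (be h)) => oh; rewrite -be_op oh.
have be_prev h : be (next_cw h) = if c (be h) then across2 (be h) else across1 (be h).
  have := be_next (next_cw h); rewrite next_cwK; case: ifP => cu ->.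
    by rewrite c1 cu m1.1.
  by rewrite c2 cu m2.1.
have gVt h : gV (t h).1.1 (t h).1.2 = gV h.1.1 h.1.2 by apply: iVI; rewrite !iVg; apply: t1.
have kFt h : kF (t h).1.1 (t h).2 = kF h.1.1 h.2 by apply: iFI; rewrite !iFk; apply: t2.
have cor_next h : cor (next_cw (op h)) = cor h.
  have := be_prev (op h); rewrite be_op ct if_neg /cor /reg; case: ifP => ch ->.
    by rewrite c1 ct ch /= gVt.
  by rewrite c2 ct ch /= kFt.
have cor_in h h' : c (be h) = c (be h') -> cor h = cor h' ->
    (if c (be h) then label1 g (be h) = label1 g (be h') else label2 k (be h) = label2 k (be h')).
  rewrite /cor /reg => <-; case: ifP => _ [] e; rewrite /label1 /label2 -?iVg -?iFk ?e //.
have side_at e h : h.1.1 = e -> exists h', h'.1 = e /\ be h' = h.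
  by move=> he; exists (ga h); rewrite -be1 gaK.
have gV_cor e x : exists h, h.1 = e /\ cor h = inl (gV e x).
  have [y cy] : exists y, c (e, x, y).
    case ce: (c (e, x, false)); first by exists false.
    by exists true; rewrite -[(e, x, true)]/(across1 (e, x, false)) c1 ce.
  have [h [h1 hb]] := side_at e (e, x, y) erefl; exists h; split=> //.
  by rewrite /cor /reg hb cy.
have kF_cor e y : exists h, h.1 = e /\ cor h = inr (kF e y).
  have [x cx] : exists x, ~~ c (e, x, y).
    case ce: (c (e, false, y)); last by exists false; rewrite ce.
    by exists true; rewrite -[(e, true, y)]/(across2 (e, false, y)) c2 ce.
  have [h [h1 hb]] := side_at e (e, x, y) erefl; exists h; split=> //.
  by rewrite /cor /reg hb (negPf cx).
have cor_surj r : exists h, cor h = r.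
  case: r => [v|f].
    by have [e [x ->]] := gVs v; have [h [_ ch]] := gV_cor e x; exists h.
  by have [e [y ->]] := kFs f; have [h [_ ch]] := kF_cor e y; exists h.
pose sd (z : void) (b : bool) : (V + F)%type := match z with end.
have reg_conn r r' : connect (fun r1 r2 =>
      [exists h, (cor h == r1) && (cor (next_ccw h) == r2)]
      || [exists z, exists b, (sd z b == r1) && (sd z (~~ b) == r2)]) r r'.
  set A := fun r1 r2 => _ || _.
  have An h : connect A (cor h) (cor (next_ccw h)).
    by apply: connect1; rewrite /A; apply/orP; left; apply/existsP; exists h; rewrite !eqxx.
  have Ai n h : connect A (cor h) (cor (iter n (@next_ccw X) h)).
    by elim: n => [|n IHn]; [exact: connect0|exact: connect_trans IHn (An _)].
  have Ac e (i j : 'I_4) : connect A (cor (e, i)) (cor (e, j)).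
    have itE n (i' : 'I_4) : iter n (@next_ccw X) (e, i') = (e, inord ((i' + n) %% 4)).
      elim: n => [|n /= ->]; first by rewrite addn0 modn_small // inord_val.
      rewrite /next_ccw /=; congr pair; apply/val_inj; rewrite /= !inordK ?ltn_pmod //.
      by rewrite -addn1 modnDml addn1 addnS.
    have := Ai (4 - i + j) (e, i); rewrite itE addnA subnKC ?(ltnW (ltn_ord i)) //.
    by rewrite modnDl modn_small // inord_val.
  have Ah h h' : h.1 = h'.1 -> connect A (cor h) (cor h').
    by case: h h' => [e i] [e' j] /= ->.
  have [h <-] := cor_surj r; have [h' <-] := cor_surj r'.
  suff H2 : forall h'', h''.1 = h'.1 -> connect A (cor h) (cor h'') by exact: H2.
    apply: (linked_ind (P := fun e => forall h'', h''.1 = e -> connect A (cor h) (cor h'')) lk _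
      (in_setT h.1) (in_setT h'.1)) => [|h'' e]; last by apply: Ah.
    move=> a b _ _ /touchP[x1 [y1 [x2 [y2 [eab _]]]]] IH h3 h3b.
    have [ha [ha1 hac]] := gV_cor a x1; have [hb [hb1 hbc]] := gV_cor b x2.
    apply: connect_trans (IH ha ha1) _; apply: connect_trans (Ah hb h3 _); last by rewrite hb1.
    rewrite hac hbc; have -> : gV a x1 = gV b x2 by apply: iVI; rewrite !iVg.
    exact: connect0.
pose pi := @next_cw X \o op.
have pi_inj : injective pi.
  by apply: inj_comp (inv_inj opK); apply: can_inj (@next_cwK X).
have be_pi h : be (pi h) = if c (be h) then across1 (t (be h)) else across2 (t (be h)).
  by rewrite /pi /= be_prev be_op ct if_neg.
have cor_fconnect h h' : cor h = cor h' -> fconnect pi h h'.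
  have lift (a : quad_side X -> quad_side X) u : (forall h, c (a h) = ~~ c h) ->
      (forall h, c (be h) = u -> be (pi h) = a (t (be h))) -> c (be h) = u ->
      fconnect (a \o t) (be h) (be h') -> fconnect pi h h'.
    move=> ca bp hu /iter_findex; set n := findex _ _ _ => hn.
    have it m : be (iter m pi h) = iter m (a \o t) (be h) /\ c (be (iter m pi h)) = u.
      elim: m => [//|m [IH1 IH2]]; rewrite !iterS bp // -IH1 /=; split=> //.
      by rewrite ca ct negbK.
    have <- : iter n pi h = h' by apply: (can_inj beK); rewrite (it n).1.
    exact: fconnect_iter.
  rewrite /cor /reg; case: ifP => ch; case: ifP => ch' // [] e.
    apply: (lift (@across1 X) true) => // [x cx|]; first by rewrite be_pi cx.
    apply: (alternate_fconnect (o := c)) => //; last by rewrite ch ch'.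
    by apply: oc1; rewrite /label1 -!iVg e.
  apply: (lift (@across2 X) false) => // [x cx|]; first by rewrite be_pi cx.
  apply: (alternate_fconnect (o := c)) => //; last by rewrite ch ch'.
  by apply: oc2; rewrite /label2 -!iFk e.
have fcardE : fcard pi predT = #|{: V + F}|.
  by have [_ ->] := fcard_labels pi_inj cor_next cor_surj.
have eul : #|X| + 2 * #|{: V + F}| = 2 + 2 * #|X| + (fcard (@next_cw X \o op) predT + 2 * #|{: void}|).
  by rewrite -/pi fcardE card_sum euler card_void; lia.
pose D := @LinkDiagram X void (V + F)%type op cor sd (inl (gV e0 false)) opK opN cor_next reg_conn eul.
pose sh (r : V + F) := if r is inl _ then true else false.
have sh_cor h : sh (cor h) = c (be h) by rewrite /cor /reg; case: ifP.
have sh_corner (h : half_edge (crossing D)) : sh (@corner D h) != sh (@corner D (next_ccw h)).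
  by rewrite /= !sh_cor be_next; case: ifP => ch; rewrite ?c1 ?c2 ch.
have sh_side (z : circle D) : sh (@side D z true) != sh (@side D z false) by case: z.
pose s := @Coloring D sh sh_corner sh_side.
have cornerE h e : h.1 = e -> exists i : 'I_4, @corner D (e, i) = cor h.
  by case: h => c0 i /= <-; exists i.
have corner_cases (e : X) (i : 'I_4) : (exists x, cor (e, i) = inl (gV e x)) \/ (exists y, cor (e, i) = inr (kF e y)).
  rewrite /cor /reg be1 /=; case: ifP => _; [left; exists (be (e, i)).1.2|right; exists (be (e, i)).2]; by [].
have dep1 : depicts (G := checkerboard_graph s true) (fun e : X => e) g sg.
  split; first by exists id.
  exists (fun e x => exist _ (inl (gV e x)) (eqxx true) : colored_region s true); split.
  - move=> e; apply/setP=> r; rewrite !inE -!val_eqE /=; apply/existsP/orP => [[i /eqP ri]|].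
      have := valP r; rewrite /= -ri; have [[[] ->]|[y ->]] := corner_cases e i => // _; [right|left]; exact: eqxx.
    have hit x : val r == inl (gV e x) -> exists i : 'I_4, cor (e, i) == val r.
      move=> /eqP ->; have [h [h1 hc]] := gV_cor e x.
      by have [i ei] := cornerE h e h1; exists i; rewrite -hc -ei.
    by case; apply: hit.
  - by move=> e x e' x'; rewrite -val_eqE /= (inj_eq (@inl_inj _ _)) -(inj_eq iVI) !iVg.
  - case=> [[v|f] //= sr]; have [e [x vx]] := gVs v; exists e, x.
    by apply/val_inj; rewrite /= vx.
  - by move=> e; rewrite /= /crossing_sign /= sh_cor be0 negbK.
have dep2 : depicts (G := checkerboard_graph s false) (fun e : X => e) k (fun e => ~~ sg e).
  split; first by exists id.
  exists (fun e x => exist _ (inr (kF e x)) (eqxx false) : colored_region s false); split.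
  - move=> e; apply/setP=> r; rewrite !inE -!val_eqE /=; apply/existsP/orP => [[i /eqP ri]|].
      have := valP r; rewrite /= -ri; have [[y ->]|[[] ->]] := corner_cases e i => // _; [right|left]; exact: eqxx.
    have hit x : val r == inr (kF e x) -> exists i : 'I_4, cor (e, i) == val r.
      move=> /eqP ->; have [h [h1 hc]] := kF_cor e x.
      by have [i ei] := cornerE h e h1; exists i; rewrite -hc -ei.
    by case; apply: hit.
  - by move=> e x e' x'; rewrite -val_eqE /= (inj_eq (@inr_inj _ _)) -(inj_eq iFI) !iFk.
  - case=> [[v|f] //= sr]; have [e [x fx]] := kFs f; exists e, x.
    by apply/val_inj; rewrite /= fx.
  - by move=> e; rewrite /= /crossing_sign /= sh_cor be0.
exists D, s, (fun e : X => e); split=> //.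
exists s => -[]; first exact: depicts_connected e0 dep1 lk.
by apply: (depicts_connected (k := g) e0 dep2); rewrite linkedC.
Qed.

End Realization.

(** * Forests and even sets of edges *)

Section Forests.

Variable G : graph.

Definition crosses (q : vertex G -> bool) (e : edge G) :=
  [exists u in ends e, exists v in ends e, q u && ~~ q v].

(** The elements of the cycle space. *)
Definition even_set (S : {set edge G}) :=
  forall q : vertex G -> bool, \big[addb/false]_(e in S) crosses q e = false.

Lemma crossesE q e u v : ends e = [set u; v] -> crosses q e = q u (+) q v.
Proof.
move=> eE; apply/exists_inP/idP => [[a]|].
  rewrite eE !inE => ha /exists_inP[b]; rewrite ?eE !inE => hb /andP[].
  by case/orP: ha => /eqP ->; case/orP: hb => /eqP -> -> // /negPf ->.
case qu: (q u); case qv: (q v) => // _.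
  by exists u; rewrite eE ?inE ?eqxx //; apply/exists_inP; exists v; rewrite ?inE ?eqxx ?orbT ?qu ?qv.
by exists v; rewrite eE ?inE ?eqxx ?orbT //; apply/exists_inP; exists u; rewrite ?inE ?eqxx ?orbT ?qu ?qv.
Qed.

Lemma ends_with (e : edge G) u : u \in ends e -> exists v, ends e = [set u; v].
Proof.
move=> ue; have [no|[v]] := set_0Vmem (ends e :\ u).
  by exists u; rewrite -(setD1K ue) no setUC set0U setUid.
move=> ve; exists v; apply/eqP; rewrite eq_sym eqEcard subUset !sub1set ue /=.
have [vu ve'] : v != u /\ v \in ends e by move: ve; rewrite !inE => /andP.
rewrite ve' cards2 eq_sym vu; by have /andP[] := card_ends e.
Qed.

Let R : rel (vertex G * edge G) := fun p q => ends p.2 == [set p.1; q.1].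

Lemma path_parity q p c : path R p c ->
  \big[addb/false]_(x <- belast p c) crosses q x.2 = q p.1 (+) q (last p c).1.
Proof.
elim: c p => [|z c IHc] p /=; first by rewrite big_nil addbb.
by case/andP=> /eqP /crossesE ep /IHc h; rewrite big_cons h ep addbA addbK.
Qed.

Lemma cycle_even c : graph_cycle c -> even_set [set e in unzip2 c].
Proof.
case/and4P; case: c => // p c _ _ un cy q.
rewrite (eq_bigl (mem (unzip2 (p :: c)))) => [|e]; last by rewrite inE.
rewrite -(big_uniq _ un) big_map.
have := path_parity q (cy : path R p (rcons c p)).
by rewrite belast_rcons last_rcons addbb.
Qed.

Lemma path_ends p c z : path R p (rcons c z) ->
  forall e v, e \in unzip2 (p :: c) -> v \in ends e -> v \in unzip1 (p :: rcons c z).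
Proof.
elim: c p => [|p' c IHc] p /=.
  by rewrite andbT => /eqP pE e v; rewrite inE => /eqP ->; rewrite pE !inE.
case/andP=> /eqP pE pp e v; rewrite inE => /orP[/eqP ->|].
  by rewrite pE !inE; case/orP=> ->; rewrite ?orbT.
by move=> ee ve; rewrite inE (IHc _ pp e v ee ve) orbT.
Qed.

Lemma path_uniq_edges p c z : path R p (rcons c z) ->
  uniq (unzip1 (p :: rcons c z)) -> uniq (unzip2 (p :: c)).
Proof.
elim: c p => [|p' c IHc] p //= /andP[/eqP pE pp] /andP[np un].
have := IHc p' pp un => /= ->; rewrite andbT; apply: contra np => pin.
by apply: (path_ends pp pin); rewrite pE !inE eqxx.
Qed.

(** A path in [S] is extended at its first vertex by another edge of [S] there, which exists by
   parity. Either this edge closes a cycle, or the path gets longer, which cannot go on beyond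
   the number of vertices. *)
Lemma even_cycle (S : {set edge G}) : even_set S -> S != set0 ->
  exists2 c, graph_cycle c & {subset unzip2 c <= S}.
Proof.
move=> ev /set0Pn[e1 e1S].
have [x1 x1e1] : exists x, x \in ends e1.
  by apply/set0Pn; rewrite -card_gt0; have /andP[] := card_ends e1.
(* The edge of the last pair of [c] only starts at its vertex; its other end is arbitrary. *)
pose good (c : seq (vertex G * edge G)) := if c is p :: c' then
  [&& path R p c', uniq (unzip1 c), p.1 \in ends p.2 & all (mem S) (unzip2 c)] else false.
suff [//|[c [gc sc]]] : (exists2 c, graph_cycle c & {subset unzip2 c <= S}) \/
    exists c, good c /\ size c = #|vertex G|.+1.
  have un : uniq (unzip1 c) by case: c gc {sc} => // p c /and4P[].
  have := card_uniqP un; rewrite size_map sc => h.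
  by have := max_card (mem (unzip1 c)); rewrite h ltnn.
elim: #|vertex G| => [|n [|[[|[x0 e0] c] [// gc sc]]]]; last 2 first.
- by left.
- move: gc => /and4P[/= pc un x0e0 /andP[e0S cS]].
  have [y0 e0E] := ends_with x0e0.
  have [lp|nl] := eqVneq x0 y0.
    left; exists [:: (x0, e0)]; last by move=> e; rewrite inE => /eqP ->.
    by rewrite /graph_cycle /= {2}lp e0E eqxx.
  have [e [eS ne ce]] : exists e, [/\ e \in S, e != e0 & crosses (pred1 x0) e].
    case: (boolP [exists e, [&& e \in S, e != e0 & crosses (pred1 x0) e]]).
      by case/existsP=> e /and3P[]; exists e.
    move/existsPn => no; have := ev (pred1 x0); rewrite (bigD1 e0) //= big1.
      by rewrite (crossesE _ e0E) /= eqxx [y0 == x0]eq_sym (negPf nl).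
    move=> e /andP[eS ne]; apply/negbTE; have := no e; by rewrite eS ne.
  have [y eE ny] : exists2 y, ends e = [set y; x0] & y != x0.
    case/exists_inP: ce => u ue /exists_inP[v ve] /andP[/= /eqP ux nv].
    exists v; rewrite // setUC; rewrite ux in ue; apply/eqP.
    rewrite eq_sym eqEcard subUset !sub1set ue ve cards2 eq_sym nv.
    by have /andP[] := card_ends e.
  case: (boolP (y \in unzip1 c)) => [/mapP[[y' ei] yc /= yy']|nyc]; last first.
    right; exists ((y, e) :: (x0, e0) :: c); split; last by rewrite -sc.
    rewrite /good /= /R /= eE !eqxx pc /= inE negb_or ny nyc un /= !inE eqxx /=.
    by rewrite eS e0S cS.
  left; move: yc; rewrite -{y'}yy' => /splitPr cE.
  case: cE pc un cS sc {nl} => c1 c2 pc un cS sc.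
  have {}pc : path R (x0, e0) (rcons c1 (y, e)).
    move: pc; rewrite cat_path rcons_path => /andP[-> /= /andP[h _]].
    exact: h.
  have {}un : uniq (unzip1 ((x0, e0) :: rcons c1 (y, e))).
    move: un; rewrite /= /unzip1 map_cat map_rcons /= -cats1 -cat_rcons mem_cat negb_or.
    by rewrite cats1 cat_uniq => /andP[/andP[-> _] /andP[-> _]].
  exists ((y, e) :: (x0, e0) :: c1); last first.
    move=> a; rewrite /= !inE => /or3P[/eqP ->|/eqP ->|ac] //.
    apply: (allP cS); by rewrite /unzip2 map_cat mem_cat ac.
  apply/and4P; split=> //.
  + have := un; rewrite -rcons_cons /unzip1 map_rcons rcons_uniq => h; exact: h.
  + have ue := path_uniq_edges pc un; apply/andP; split; last exact: ue.
    rewrite inE negb_or ne {ue} /=.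
    apply/negP => ec1; move: pc un; case: c1 ec1 {cS sc} => // p' c1 ec1 /= /andP[_ pc] /andP[nx _].
    case/negP: nx; apply: (path_ends pc ec1); by rewrite eE !inE eqxx orbT.
  + by rewrite /= eE eqxx.
by right; exists [:: (x1, e1)]; rewrite /good /= x1e1 e1S.
Qed.

(** Being a forest depends on the cycle space only. *)
Lemma forestP (F : {set edge G}) :
  forest F <-> forall S : {set edge G}, S \subset F -> even_set S -> S = set0.
Proof.
split=> [fo S sSF ev|H c gc sub].
  apply/eqP; apply: contraT => /(even_cycle ev)[c gc sub].
  by case: (fo c gc) => e /sub; apply: (subsetP sSF).
have : [set e in unzip2 c] = set0.
  by apply: H; [apply/subsetP=> e; rewrite inE => /sub|exact: cycle_even].
case: c gc {sub} => // p c _ /setP/(_ p.2); by rewrite !inE eqxx.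
Qed.

Definition even_setb (S : {set edge G}) :=
  [forall q : {ffun vertex G -> bool}, ~~ \big[addb/false]_(e in S) crosses q e].

Lemma even_setP S : reflect (even_set S) (even_setb S).
Proof.
apply: (iffP forallP) => [H q|H q]; last by rewrite H.
rewrite -[RHS](negPf (H [ffun v => q v])); apply: eq_bigr => e _.
have [u ue] : exists x, x \in ends e.
  by apply/set0Pn; rewrite -card_gt0; have /andP[] := card_ends e.
by have [v eE] := ends_with ue; rewrite !(crossesE _ eE) !ffunE.
Qed.

Definition forestb (F : {set edge G}) :=
  [forall S : {set edge G}, (S \subset F) && even_setb S ==> (S == set0)].

Lemma forestbP F : reflect (forest F) (forestb F).
Proof.
apply: (iffP forallP) => [H|/forestP H S].
  apply/forestP => S sSF /even_setP ev; apply/eqP; move: (H S); by rewrite sSF ev.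
by apply/implyP => /andP[sSF /even_setP ev]; rewrite (H S sSF ev).
Qed.

Lemma forestS (F F' : {set edge G}) : F' \subset F -> forest F -> forest F'.
Proof. by move=> s /forestP H; apply/forestP => S sS; apply: H; apply: subset_trans s. Qed.

Lemma forest_maximal (F : {set edge G}) : forest F -> exists2 M, maximal_forest M & F \subset M.
Proof.
move=> /forestbP fF; have [M /maxsetP[fM mM] FM] := maxset_exists fF.
exists M => //; split; first exact/forestbP.
by move=> F' sF' /forestbP fF'; apply: mM.
Qed.

Lemma dependentP (F : {set edge G}) : ~ forest F -> exists S : {set edge G}, [/\ S \subset F, even_set S & S != set0].
Proof.
move=> /forestbP; rewrite negb_forall => /existsP[S]; rewrite negb_imply => /andP[/andP[sS /even_setP ev] n0].
by exists S.
Qed.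

Lemma even_setD (S C : {set edge G}) : C \subset S -> even_set S -> even_set C -> even_set (S :\: C).
Proof.
by move=> sCS eS eC q; have := eS q; rewrite (big_setID C) /= (setIidPr sCS) eC.
Qed.

End Forests.

(** A minimal nonempty even set is a minimal dependent set, so its image is one as well and is
   therefore even; every even set is a disjoint union of such sets. *)
Lemma even_set_image (G H : graph) (f : edge G -> edge H) : injective f ->
  (forall F : {set edge G}, forest F <-> forest (f @: F)) ->
  forall S : {set edge G}, even_set S -> even_set (f @: S).
Proof.
move=> fI ff S; move: {2}#|S| (leqnn #|S|) => n; elim: n S => [|n IHn] S cS ev.
  have -> : S = set0 by apply/eqP; rewrite -cards_eq0 -leqn0.
  by rewrite imset0 => q; rewrite big_set0.
have [->|nS] := eqVneq S set0; first by rewrite imset0 => q; rewrite big_set0.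
have evS : even_setb S && (S != set0) by rewrite nS andbT; apply/even_setP.
have [C /minsetP[/andP[/even_setP evC nC] minC] CS] := minset_exists (P := fun S : {set edge G} => even_setb S && (S != set0)) evS.
have dep (D : {set edge G}) : D \subset C -> forall D' : {set edge G}, D' \subset D -> even_set D' -> D' != set0 -> D = C.
  move=> DC D' D'D evD' nD'; apply/eqP; rewrite eqEsubset DC.
  by rewrite -(minC D') ?(subset_trans D'D) // nD' andbT; apply/even_setP.
have evfC : even_set (f @: C).
  have nf : ~ forest (f @: C).
    by move=> /ff /forestP h; case/eqP: nC; apply: h.
  have [C' [C'C evC' nC']] := dependentP nf.
  have C'E : C' = f @: (f @^-1: C').
    apply/setP=> e; apply/idP/imsetP => [eC'|[a]]; last by rewrite inE => ? ->.
    by have /imsetP[a _ ea] := subsetP C'C _ eC'; exists a; rewrite // inE -ea.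
  have DC : f @^-1: C' \subset C.
    apply/subsetP=> a; rewrite inE => /(subsetP C'C) /imsetP[b bC /fI ->]; exact: bC.
  have nfD : ~ forest (f @^-1: C').
    by move=> /ff; rewrite -C'E => /forestP h; case/eqP: nC'; apply: h.
  have [D' [D'D evD' nD']] := dependentP nfD.
  by rewrite -(dep _ DC D' D'D evD' nD') -C'E.
have evR : even_set (f @: (S :\: C)).
  apply: IHn; last exact: even_setD.
  have := cardsD S C; rewrite (setIidPr CS); have := card_gt0 C; rewrite nC; lia.
move=> q; have := evfC q; have := evR q; rewrite !big_imset /=; try by move=> ? ? _ _; apply: fI.
by rewrite [X in _ -> _ -> X = _](big_setID C) /= (setIidPr CS) => -> ->.
Qed.

Lemma two_isomorphism_forest (G H : graph) (f : edge G -> edge H) : two_isomorphism f ->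
  forall F : {set edge G}, forest F <-> forest (f @: F).
Proof.
move=> [bf mf] F; split=> /forest_maximal[M mM FM].
  have [fM _] := (mf M).1 mM; exact: forestS (imsetS f FM) fM.
have [f' fK f'K] := bf.
have ME : f @: (f' @: M) = M.
  by rewrite -imset_comp -[RHS]imset_id; apply: eq_imset => e /=; rewrite f'K.
have [fM _] : maximal_forest (f' @: M) by apply/mf; rewrite ME.
apply: forestS fM; apply/subsetP => e eF; apply/imsetP; exists (f e); rewrite ?fK //.
by apply: (subsetP FM); apply: imset_f.
Qed.

Lemma forest_two_isomorphism (G H : graph) (f : edge G -> edge H) : bijective f ->
  (forall F : {set edge G}, forest F <-> forest (f @: F)) -> two_isomorphism f.
Proof.
move=> [f' fK f'K] ff; split=> [|F]; first by exists f'.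
have ME (M : {set edge H}) : f @: (f' @: M) = M.
  by rewrite -imset_comp -[RHS]imset_id; apply: eq_imset => e /=; rewrite f'K.
split=> -[fo mx]; split; try exact/ff.
  move=> F' sF fF'; rewrite -(ME F'); suff -> : f' @: F' = F by []; apply: mx.
    by apply/subsetP => e eF; apply/imsetP; exists (f e); rewrite ?fK //; apply: (subsetP sF); apply: imset_f.
  by apply/ff; rewrite ME.
move=> F' sF /ff fF'; apply: (imset_inj (can_inj fK)); apply: mx => //.
exact: imsetS.
Qed.

Lemma isomorphism_two_isomorphism (G H : graph) fV (fE : edge G -> edge H) :
  graph_isomorphism fV fE -> two_isomorphism fE.
Proof.
move=> [[gV fVK gVK] bE eE]; apply: forest_two_isomorphism => //.
have [gE fEK gEK] := bE; have fEI := can_inj fEK.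
have cr q e : crosses q (fE e) = crosses (q \o fV) e.
  rewrite /crosses eE; apply/exists_inP/exists_inP => [[u /imsetP[a ae ->] /exists_inP[v /imsetP[b be ->] ab]]|
    [a ae /exists_inP[b be ab]]].
    by exists a => //; apply/exists_inP; exists b.
  by exists (fV a); rewrite ?imset_f //; apply/exists_inP; exists (fV b); rewrite ?imset_f.
have ev (S : {set edge G}) : even_set S <-> even_set (fE @: S).
  split=> evS q.
    by rewrite big_imset /= => [|? ? _ _]; [rewrite (eq_bigr _ (fun e _ => cr q e)); apply: evS|apply: fEI].
  have := evS (q \o gV); rewrite big_imset /= => [|? ? _ _]; last exact: fEI.
  move=> h; rewrite -[RHS]h; apply: eq_bigr => e _; rewrite cr; apply: eq_existsb => u; congr (_ && _).
  by apply: eq_existsb => v; rewrite /= !fVK.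
move=> F; split=> /forestP H0; apply/forestP => S sS evS.
  have SE : S = fE @: (gE @: S).
    by rewrite -imset_comp -[LHS]imset_id; apply: eq_imset => e /=; rewrite gEK.
  rewrite SE (H0 (gE @: S)) ?imset0 //; last by apply/ev; rewrite -SE.
  by apply/subsetP=> a /imsetP[b /(subsetP sS) /imsetP[d dF ->] ->]; rewrite fEK.
have /eqP := H0 (fE @: S) (imsetS fE sS) ((ev S).1 evS).
by rewrite -cards_eq0 card_imset // cards_eq0 => /eqP.
Qed.

(** * Equivalence of diagrams *)

Lemma depicts_even (X : finType) (G : sgraph) (th : X -> edge G) g sg w :
  depicts th g sg -> orthogonal setT g w <-> even_set (th @: [set e | w e]).
Proof.
move=> [bth [rg [eg pg sug _]]].
have sum q r : (forall e x, q (rg e x) = r (g e x)) ->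
    dot setT w (coboundary g r) = \big[addb/false]_(e in th @: [set e | w e]) crosses q e.
  move=> qr; rewrite big_imset /=; last by move=> ? ? _ _; apply: bij_inj.
  rewrite /dot (eq_bigl xpredT) => [|e]; last by rewrite inE.
  rewrite [RHS]big_mkcond; apply: eq_bigr => e _; rewrite inE (crossesE _ (eg e)) !qr.
  by rewrite /coboundary; case: (w e).
split=> [o q|ev r].
  have [r rE] : exists r, forall e x, q (rg e x) = r (g e x).
    exists (fun n => [exists p : X * bool, (g p.1 p.2 == n) && q (rg p.1 p.2)]) => e x.
    apply/idP/existsP => [qe|[[e' x'] /= /andP[]]]; first by exists (e, x); rewrite /= eqxx.
    by rewrite -pg => /eqP ->.
  by rewrite -(sum _ _ rE) o.
pose q v := [exists p : X * bool, (rg p.1 p.2 == v) && r (g p.1 p.2)].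
rewrite (sum q) // => e x; apply/existsP/idP => [[[e' x'] /= /andP[]]|re].
  by rewrite pg => /eqP ->.
by exists (e, x); rewrite /= eqxx.
Qed.

(** Cuts are the orthogonal complement of the vectors orthogonal to all cuts. *)
Lemma orthogonal_same_cut (X : finType) (A : {set X}) (g k g' k' : labeling X) w :
  abstract_dual A g k -> abstract_dual A g' k' ->
  (forall w, orthogonal A g' w -> orthogonal A g w) -> cut A g w -> cut A g' w.
Proof.
move=> dl [o' d' _] H cw; apply: d' => r; rewrite dotC.
apply: orthogonal_cut cw; apply: H => q; rewrite dotC; exact: o'.
Qed.

(** Connected graphs without edges have a single vertex. *)
Lemma crossingless_isomorphic (D D' : link_diagram) (s : coloring D) (s' : coloring D') b b' :
  checkerboard_connected D -> checkerboard_connected D' ->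
  #|crossing D| = 0 -> #|crossing D'| = 0 ->
  signed_isomorphic (checkerboard_graph s b) (checkerboard_graph s' b').
Proof.
have one (E : link_diagram) (u : coloring E) c : checkerboard_connected E -> #|crossing E| = 0 ->
    exists v : vertex (checkerboard_graph u c), forall v', v' = v.
  move=> con /card0_eq E0; have [/card_gt0P[v _] cv] := coloring_connected u c con.
  exists v => v'; have /connectP[[|z p] //= /andP[/existsP[e _] _]] := cv v v'.
  by have := E0 e.
move=> con con' X0 X0'; have [v vE] := one _ s b con X0; have [v' vE'] := one _ s' b' con' X0'.
have none (E : link_diagram) : #|crossing E| = 0 -> crossing E -> False.
  by move=> /card0_eq E0 e; have := E0 e.
have [N N'] := (none _ X0, none _ X0').
exists (fun _ => v'), (fun e => False_rect (crossing D') (N e)); split; last by move=> e; case: (N e).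
split.
- by exists (fun _ => v) => u; rewrite ?(vE u) ?(vE' u).
- by exists (fun e => False_rect (crossing D) (N' e)) => e; [case: (N e)|case: (N' e)].
- by move=> e; case: (N e).
Qed.

Lemma equiv1_equiv2 D D' : equiv1 D D' -> equiv2 D D'.
Proof.
elim=> [E E' [s [b [s' [b' [fV [fE [iso sg]]]]]]]|E|E E' _|E1 E2 E3 _ h1 _ h2].
- apply: rst_step; exists s, b, s', b'; exists fE; split=> //.
  exact: isomorphism_two_isomorphism iso.
- exact: rst_refl.
- exact: rst_sym.
- exact: rst_trans h1 h2.
Qed.

Definition realizes (X : finType) (sg : X -> bool) (D : link_diagram) (p : labeling X * labeling X) :=
  exists (s : coloring D) b (th : X -> crossing D),
    depicts (G := checkerboard_graph s b) th p.1 sg /\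
    depicts (G := checkerboard_graph s (~~ b)) th p.2 (fun e => ~~ sg e).

Lemma realizes_exists (X : finType) (e0 : X) (sg : X -> bool) (p : labeling X * labeling X) :
  planar_pair setT p.1 p.2 -> exists D : connected_diagram, realizes sg (sval D) p.
Proof.
move=> pp; have [D [s [th [con d1 d2]]]] := realization e0 sg pp.
by exists (exist _ D con); exists s, true, th.
Qed.

Lemma realizes_same (X : finType) (sg : X -> bool) (p p' : labeling X * labeling X)
    (D D' : connected_diagram) : same_on setT p.1 p'.1 \/ same_on setT p.2 p'.2 ->
  realizes sg (sval D) p -> realizes sg (sval D') p' -> equiv1 D D'.
Proof.
move=> sm [s [b [th [d1 d2]]]] [s' [b' [th' [d1' d2']]]]; apply: rst_step.
case: sm => sm; [exists s, b, s', b'|exists s, (~~ b), s', (~~ b')].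
  exact: depicts_isomorphic d1 d1' sm.
exact: depicts_isomorphic d2 d2' sm.
Qed.

(** The intermediate planar pairs are realized by diagrams, and consecutive ones share a
   signed checkerboard graph. *)
Lemma reach_equiv1 (X : finType) (e0 : X) (sg : X -> bool) g k g' k' (D D' : connected_diagram) :
  planar_pair setT g k -> reach setT g k g' k' ->
  realizes sg (sval D) (g, k) -> realizes sg (sval D') (g', k') -> equiv1 D D'.
Proof.
move=> pl re; move: D D' pl; rewrite /reach in re.
suff H p p' : clos_refl_sym_trans _ (planar_step setT) p p' -> forall D D' : connected_diagram,
    planar_pair setT p.1 p.2 -> realizes sg (sval D) p -> realizes sg (sval D') p' -> equiv1 D D'.
  by move=> D D' pl; apply: (H _ _ re).
elim=> {p p' re} [p p' [_ _ sm]|p|[p q] [p' q'] re IH|[p1 q1] [p2 q2] p3 re1 IH1 re2 IH2] D D' pl h h'.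
- exact: realizes_same sm h h'.
- by apply: realizes_same h h'; left.
- by apply: rst_sym; apply: IH h' h; apply: reach_planar pl; apply: reach_sym.
- have pl2 := reach_planar re1 pl; have [D2 h2] := realizes_exists e0 sg (p := (p2, q2)) pl2.
  by apply: rst_trans (IH1 _ _ pl h h2) (IH2 _ _ pl2 h2 h').
Qed.

Lemma diagram_realizes (D : link_diagram) (s : coloring D) b (X : finType) (th : X -> crossing D) (e0 : X) :
  checkerboard_connected D -> bijective th ->
  realizes (fun e => crossing_sign s b (th e)) D (diagram_label s th b, diagram_label s th (~~ b)).
Proof.
move=> con bth; exists s, b, th; split; first exact: diagram_depicts.
have [bb [rg [r1 r2 r3 r4]]] := diagram_depicts s con bth e0 (~~ b).
split=> //; exists rg; split=> // e; rewrite r4 /crossing_sign.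
by case: (b); rewrite /= ?negbK.
Qed.

Lemma two_isomorphic_equiv1 (D D' : connected_diagram) :
  share_checkerboard signed_two_isomorphic D D' -> equiv1 D D'.
Proof.
move=> [s [b [s' [b' [f [iso sgn]]]]]].
have [bf _] := iso; have [con con'] := (proj2_sig D, proj2_sig D').
have cX : #|crossing (sval D)| = #|crossing (sval D')| by apply: bij_eq_card bf.
have [/card0_eq X0|] := posnP #|crossing (sval D)|.
  apply: rst_step; exists s, b, s', b'.
  by apply: crossingless_isomorphic => //; rewrite -?cX; apply: eq_card0.
case/card_gt0P=> e0 _.
have bid : bijective (@id (crossing (sval D))) by exists id.
pose g := diagram_label s id b; pose k := diagram_label s id (~~ b).
pose f' : crossing (sval D) -> crossing (sval D') := f.
pose g' := diagram_label s' f' b'; pose k' := diagram_label s' f' (~~ b').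
have p : planar_pair setT g k := diagram_planar s b con bid e0.
have p' : planar_pair setT g' k' := diagram_planar s' b' con' bf e0.
have h := diagram_realizes s b e0 con bid.
have h' : realizes (fun e => crossing_sign s b e) (sval D') (g', k').
  have [s2 [b2 [th2 [d1 d2]]]] := diagram_realizes s' b' e0 con' bf.
  exists s2, b2, th2; split; [case: d1|case: d2] => bt [rg [r1 r2 r3 r4]];
    by split=> //; exists rg; split=> // e; rewrite r4 /= -[crossing_sign s b e]sgn.
apply: (reach_equiv1 e0 p _ h h').
have ff := two_isomorphism_forest iso.
have [f2 fK f2K] := bf.
have d := diagram_depicts s con bid e0 b; have d' := diagram_depicts s' con' bf e0 b'.
have toH w : orthogonal setT g w -> orthogonal setT g' w.
  move=> /(depicts_even w d) ev; apply/(depicts_even w d').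
  rewrite imset_id in ev; exact: even_set_image (bij_inj bf) ff _ ev.
have toG w : orthogonal setT g' w -> orthogonal setT g w.
  move=> /(depicts_even w d') ev; apply/(depicts_even w d); rewrite imset_id.
  have ff' (F : {set crossing (sval D')}) : forest (G := checkerboard_graph s' b') F <->
      forest (G := checkerboard_graph s b) (f2 @: F).
    rewrite (ff (f2 @: F)); have -> : f @: (f2 @: F) = F; last by [].
    by rewrite -imset_comp -[RHS]imset_id; apply: eq_imset => e /=; rewrite f2K.
  have := even_set_image (G := checkerboard_graph s' b') (H := checkerboard_graph s b) (can_inj f2K) ff' ev.
  have -> // : f2 @: (f @: [set e | w e]) = [set e | w e].
  by rewrite -imset_comp -[RHS]imset_id; apply: eq_imset => e /=; rewrite fK.
apply: (same_cuts_reach p p') => w; split.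
  exact: orthogonal_same_cut (planar_dual p) (planar_dual p') toG.
exact: orthogonal_same_cut (planar_dual p') (planar_dual p) toH.
Qed.

Theorem theorem16 (D D' : connected_diagram) : equiv1 D D' <-> equiv2 D D'.
Proof.
split; first exact: equiv1_equiv2.
elim=> [E E'|E|E E' _|E1 E2 E3 _ h1 _ h2].
- exact: two_isomorphic_equiv1.
- exact: rst_refl.
- exact: rst_sym.
- exact: rst_trans h1 h2.
Qed.
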